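(* Let $p$ be a prime and let $A$ be a Henselian valuation ring which is not a field (of arbitrary rank), with field of fractions $K$ and residue field $k$, where $\operatorname{char}K=\operatorname{char}k=p$. Let $L/K$ be a non-trivial Artin–Schreier extension (of degree $p$), let $B$ be the integral closure of $A$ in $L$, and let $\sigma$ be a generator of $\operatorname{Gal}(L/K)$. Then the following equality of ideals of $A$ holds: $$\mathscr{H}=\big(N_{L/K}(\mathscr{J}_\sigma)\big).$$
   Context: $\mathscr{J}_\sigma$ is the ideal of $B$ generated by $\{\sigma(b)/b-1\mid b\in L^\times\}$ (it does not depend on the choice of $\sigma$). $\big(N_{L/K}(\mathscr{J}_\sigma)\big)$ denotes the ideal of $A$ generated by the norms $N_{L/K}(x)$, $x\in\mathscr{J}_\sigma$. $\mathscr{H}$ is the $A$-submodule of $K$ generated by $\{1/h\mid h\in K^\times$ such that the solutions of $T^p-T=h$ generate $L/K\}$ (it is an integral ideal of $A$). *)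

(* Defs.v *)
From HB Require Import structures.
From mathcomp Require Import all_boot all_order all_algebra all_field.
Set Implicit Arguments. Unset Strict Implicit. Unset Printing Implicit Defensive.
Import GRing.Theory.
Local Open Scope ring_scope.

Section Defs.
Variable K : fieldType.

Definition is_valuation_ring (A : K -> Prop) : Prop :=
  [/\ A 1, (forall x y, A x -> A y -> A (x - y)), (forall x y, A x -> A y -> A (x * y))
    & (forall x, x != 0 -> A x \/ A x^-1)].

Definition vmax (A : K -> Prop) (x : K) : Prop := A x /\ (x = 0 \/ ~ A x^-1).

Definition not_field (A : K -> Prop) : Prop := exists x, [/\ A x, x != 0 & ~ A x^-1].

Definition henselian (A : K -> Prop) : Prop :=
  forall (f : {poly K}) (a : K), f \is monic -> (forall i, A f`_i) -> A a ->
    vmax A f.[a] -> ~ vmax A (f^`()).[a] ->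
    exists b, [/\ A b, root f b & vmax A (b - a)].

Variable L : fieldExtType K.

Definition int_closure (A : K -> Prop) (x : L) : Prop :=
  exists f : {poly K}, [/\ f \is monic, (forall i, A f`_i) & (map_poly (in_alg L) f).[x] = 0].

Definition normLK (x : L) : K :=
  \det (passmx.mxof (vbasis fullv) (vbasis fullv) (amulr x)).

Definition gal_generator (s : 'End(L)) : Prop :=
  kAut 1%VS fullv s /\
  forall t : 'End(L), kAut 1%VS fullv t -> exists n, t = iter n (fun g => (s \o g)%VF) \1%VF.

Definition J_sigma (A : K -> Prop) (s : 'End(L)) (x : L) : Prop :=
  exists (n : nat) (c b : 'I_n -> L),
    [/\ forall i, int_closure A (c i), forall i, b i != 0 &
        x = \sum_(i < n) c i * (s (b i) / b i - 1)].

Definition norm_ideal (A : K -> Prop) (s : 'End(L)) (y : K) : Prop :=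
  exists (n : nat) (a : 'I_n -> K) (x : 'I_n -> L),
    [/\ forall i, A (a i), forall i, J_sigma A s (x i) &
        y = \sum_(i < n) a i * normLK (x i)].

Definition AS_generator (p : nat) (h : K) : Prop :=
  h != 0 /\ exists alpha : L, alpha ^+ p - alpha = h%:A /\ <<1%VS; alpha>>%VS = fullv.

Definition H_module (A : K -> Prop) (p : nat) (y : K) : Prop :=
  exists (n : nat) (a h : 'I_n -> K),
    [/\ forall i, A (a i), forall i, AS_generator p (h i) &
        y = \sum_(i < n) a i / h i].

Definition AS_extension (p : nat) : Prop :=
  \dim {:L} = p /\ exists alpha : L, alpha ^+ p - alpha \in 1%VS /\ <<1%VS; alpha>>%VS = fullv.

End Defs.

(* Main.v *)
(* If alpha^p - alpha = h, then N(1/alpha) = 1/h and 1/alpha = (s(alpha)/alpha - 1)/n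
   with s(alpha) = alpha + n, which gives one inclusion.  For the other one, Henselianity makes
   the integral closure B of A in L a valuation ring, so it suffices to find, for each b <> 0,
   some c in K with (alpha - c)(s(b)/b - 1) in B.  Write b = g(alpha) with deg g < p.  If
   v(alpha - c) < 0 for all c, it is enough that every term of the Taylor expansion
   b = sum_i g_i(c) (alpha - c)^i has value >= v(b) for some c, because s adds 1 to alpha - c.
   - If v(alpha - c) has a maximum, the powers of alpha - c are valuation independent at it:
     either v(alpha - c) has order p modulo v(K), or alpha - c gives a purely inseparable
     residue extension of degree p.
   - Otherwise induct on deg g through g'.  The only obstruction is
     v(g(alpha)) > v(g'(alpha) (alpha - c)) for all c; then Newton's step from a good c
     produces, by Hensel's lemma, a root of g in K closer to alpha than allowed. *)
Require Import Defs.
From HB Require Import structures.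
From mathcomp Require Import all_boot all_order all_algebra all_field.
From mathcomp Require Import perm boolp.
From mathcomp Require Import ring.
Set Implicit Arguments. Unset Strict Implicit. Unset Printing Implicit Defensive.
Import GRing.Theory.
Local Open Scope ring_scope.

(** * The divisibility order of a valuation ring *)

(** For beta = alpha - c, N(beta) = h - (c^p - c) is again an Artin-Schreier constant of L, so N(x)
    = N(beta x) / N(beta) lies in H as soon as beta x is integral. An element x of the ideal is a
    sum involving several ratios, but B being a valuation ring, the c with the largest v(alpha - c)
    among finitely many serves all of them. The target for the Taylor terms comes from the factor
    alpha - c: if v(x) < 0, then (x + 1)^i - x^i has value at least (i - 1) v(x), and multiplying by
    x gives back i v(x), the value of the term x^i itself. The obstacle is that v has arbitrary rank
    and the extension may have defect. Values are therefore compared only through divisibility in B,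
    and when v(alpha - c) has no maximum no limit is available: bounds must be stated for all c
    close enough to alpha. Locality of B is likewise obtained without extending v to L, from norms
    alone. *)

Section ValuationOrder.
Variables (F : fieldType) (B : F -> Prop).

(* [vle x y] reads v(x) <= v(y). *)
Definition vle (x y : F) := exists2 b, B b & y = b * x.
Definition vlt (x y : F) := ~ vle y x.

Hypothesis valB : is_valuation_ring B.

Lemma vring1 : B 1. Proof. by case: valB. Qed.
Lemma vringB x y : B x -> B y -> B (x - y). Proof. by case: valB => _ + _ _; apply. Qed.
Lemma vringM x y : B x -> B y -> B (x * y). Proof. by case: valB => _ _ + _; apply. Qed.
Lemma vring0 : B 0. Proof. by rewrite -(subrr 1); apply: vringB; apply: vring1. Qed.
Lemma vringN x : B x -> B (- x). Proof. by rewrite -sub0r; apply: vringB vring0. Qed.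
Lemma vringD x y : B x -> B y -> B (x + y).
Proof. by move=> Bx By; rewrite -[y]opprK; apply/vringB/vringN. Qed.
Lemma vringX x n : B x -> B (x ^+ n).
Proof.
by move=> Bx; elim: n => [|n IHn]; rewrite ?exprS; [apply: vring1 | apply: vringM].
Qed.
Lemma vring_sum (I : Type) (r : seq I) (P : pred I) (E : I -> F) :
  (forall i, P i -> B (E i)) -> B (\sum_(i <- r | P i) E i).
Proof. by move=> BE; elim/big_ind: _ => //; [apply: vring0 | apply: vringD]. Qed.
Lemma vring_nat n : B n%:R.
Proof. by rewrite -[n]card_ord -sumr_const; apply: vring_sum => *; apply: vring1. Qed.
Lemma vringMn x n : B x -> B (x *+ n).
Proof. by move=> Bx; rewrite -mulr_natr; apply/vringM/vring_nat. Qed.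
Lemma vring_inv x : ~ B x -> B x^-1.
Proof.
case: (eqVneq x 0) => [->|x0 nBx]; first by move=> /(_ vring0).
by case: valB => _ _ _ /(_ x x0) [].
Qed.

Lemma vle_refl x : vle x x. Proof. by exists 1; rewrite ?mul1r //; apply: vring1. Qed.
Lemma vle_trans x y z : vle x y -> vle y z -> vle x z.
Proof.
by move=> [b Bb ->] [c Bc ->]; exists (c * b); rewrite ?mulrA //; apply: vringM.
Qed.
Lemma vle0 x : vle x 0. Proof. by exists 0; rewrite ?mul0r //; apply: vring0. Qed.
Lemma vle0l x : vle 0 x -> x = 0. Proof. by case=> b _ ->; rewrite mulr0. Qed.
Lemma vle_total x y : vle x y \/ vle y x.
Proof.
case: (eqVneq x 0) => [->|x0]; first by right; apply: vle0.
have [Bz|/vring_inv Bz] := EM (B (y / x)); first by left; exists (y / x); rewrite ?divfK.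
case: (eqVneq y 0) => [->|y0]; first by left; apply: vle0.
by right; exists (x / y); rewrite ?divfK // -invf_div.
Qed.
Lemma vltW x y : vlt x y -> vle x y. Proof. by case: (vle_total x y). Qed.
Lemma vle_lt_trans x y z : vle x y -> vlt y z -> vlt x z.
Proof. by move=> xy yz zx; apply: yz; apply: vle_trans zx xy. Qed.
Lemma vlt_le_trans x y z : vlt x y -> vle y z -> vlt x z.
Proof. by move=> xy yz zx; apply: xy; apply: vle_trans yz zx. Qed.
Lemma vlt_neq0 x y : vlt x y -> x != 0.
Proof. by move=> xy; apply/eqP => x0; apply: xy; rewrite x0; apply: vle0. Qed.
Lemma vlt0 x : x != 0 -> vlt x 0. Proof. by move=> /eqP x0 /vle0l. Qed.

Lemma vleM2l z x y : vle x y -> vle (z * x) (z * y).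
Proof. by move=> [b Bb ->]; exists b; rewrite // mulrCA. Qed.
Lemma vleM2r z x y : vle x y -> vle (x * z) (y * z).
Proof. by rewrite ![_ * z]mulrC; apply: vleM2l. Qed.
Lemma vleM x y z t : vle x y -> vle z t -> vle (x * z) (y * t).
Proof. by move=> xy zt; apply: vle_trans (vleM2r z xy) (vleM2l y zt). Qed.
Lemma vle_pM2l z x y : z != 0 -> vle (z * x) (z * y) -> vle x y.
Proof. by move=> z0 /(vleM2l z^-1); rewrite !mulKf. Qed.
Lemma vltM2l z x y : z != 0 -> vlt x y -> vlt (z * x) (z * y).
Proof. by move=> z0 xy /(vle_pM2l z0). Qed.
Lemma vltM2r z x y : z != 0 -> vlt x y -> vlt (x * z) (y * z).
Proof. by rewrite ![_ * z]mulrC; apply: vltM2l. Qed.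
Lemma vleX n x y : vle x y -> vle (x ^+ n) (y ^+ n).
Proof. by move=> [b Bb ->]; exists (b ^+ n); rewrite ?exprMn //; apply: vringX. Qed.

Lemma vleD x y z : vle z x -> vle z y -> vle z (x + y).
Proof.
by move=> [b Bb ->] [c Bc ->]; exists (b + c); rewrite ?mulrDl //; apply: vringD.
Qed.
Lemma vleN x y : vle x y -> vle x (- y).
Proof. by move=> [b Bb ->]; exists (- b); rewrite ?mulNr //; apply: vringN. Qed.
Lemma vleB x y z : vle z x -> vle z y -> vle z (x - y).
Proof. by move=> zx /vleN; apply: vleD. Qed.
Lemma vle_sum z (I : Type) (r : seq I) (P : pred I) (E : I -> F) :
  (forall i, P i -> vle z (E i)) -> vle z (\sum_(i <- r | P i) E i).
Proof. by move=> BE; elim/big_ind: _ => //; [apply: vle0 | move=> *; apply: vleD]. Qed.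
Lemma vltD x y z : vlt z x -> vlt z y -> vlt z (x + y).
Proof.
move=> zx zy xyz; case: (vle_total x y) => [xy|yx].
  by apply: zx; apply: vle_trans xyz; apply: vleD => //; apply: vle_refl.
by apply: zy; apply: vle_trans xyz; apply: vleD => //; apply: vle_refl.
Qed.
Lemma vltN x y : vlt x y -> vlt x (- y).
Proof. by move=> xy [b Bb e]; apply: xy; exists (- b); rewrite ?mulNr -?mulrN //; apply: vringN. Qed.
Lemma vltB x y z : vlt z x -> vlt z y -> vlt z (x - y).
Proof. by move=> zx /vltN; apply: vltD. Qed.
Lemma vlt_sum z (I : Type) (r : seq I) (P : pred I) (E : I -> F) : z != 0 ->
  (forall i, P i -> vlt z (E i)) -> vlt z (\sum_(i <- r | P i) E i).
Proof.
by move=> z0 BE; elim/big_ind: _ => //; [apply: vlt0 | move=> *; apply: vltD].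
Qed.
Lemma vlt_addr x y : vlt x y -> vle (x + y) x.
Proof.
move=> xy; apply: contrapT => yx; have := vltB yx xy.
by rewrite addrK; apply; apply: vle_refl.
Qed.
Lemma vle_addr x y : vlt x y -> vle x (x + y).
Proof. by move=> xy; apply: vleD (vle_refl x) (vltW xy). Qed.

Lemma vle1 x : vle 1 x <-> B x.
Proof. by split=> [[b Bb ->] | Bx]; [rewrite mulr1 | exists x; rewrite ?mulr1]. Qed.
Lemma vlt1 x : vlt 1 x <-> vmax B x.
Proof.
split=> [lt1x | [Bx mx] [b Bb e]].
  split; first by apply/vle1/vltW.
  case: (eqVneq x 0) => [|x0]; [by left | right => Bx].
  by apply: lt1x; exists x^-1; rewrite ?mulVf.
have x0 : x != 0 by apply: contra_eq_neq e => ->; rewrite mulr0 oner_eq0.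
by case: mx => [/eqP|]; [apply/negP | apply; rewrite -[x^-1]mul1r e mulfK].
Qed.
Lemma vltx1 x : vlt x 1 <-> ~ B x.
Proof. by split=> h1 /vle1 h2; apply: h1. Qed.
Lemma vlt_exp2l a i n : vlt a 1 -> (i < n)%N -> vlt (a ^+ n) (a ^+ i).
Proof.
move=> a1; have a0 := vlt_neq0 a1; have ak0 k : a ^+ k != 0 by rewrite expf_neq0.
elim: n => // n IHn; rewrite ltnS leq_eqVlt => /orP[/eqP->|/IHn]; last first.
  by apply: vle_lt_trans; rewrite exprS -[X in vle _ X]mul1r; apply/vleM2r/vltW.
by rewrite exprS -[X in vlt _ X]mul1r; apply: vltM2r.
Qed.
Lemma vle_div x y : y != 0 -> vle y x -> B (x / y).
Proof. by move=> y0 [b Bb ->]; rewrite mulfK. Qed.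
Lemma vlt_div x y : y != 0 -> vlt y x -> vmax B (x / y).
Proof.
move=> y0 yx; apply/vlt1; rewrite -(divff y0).
by apply: vltM2r yx; rewrite invr_eq0.
Qed.

Lemma vmaxB x : vmax B x -> B x. Proof. by case. Qed.
Lemma vmax0 : vmax B 0. Proof. by split; [apply: vring0 | left]. Qed.
Lemma vmaxD x y : vmax B x -> vmax B y -> vmax B (x + y).
Proof. by rewrite -!vlt1; apply: vltD. Qed.
Lemma vmaxN x : vmax B x -> vmax B (- x). Proof. by rewrite -!vlt1; apply: vltN. Qed.
Lemma vmaxBB x y : vmax B x -> vmax B y -> vmax B (x - y).
Proof. by rewrite -!vlt1; apply: vltB. Qed.
Lemma vmaxMl x y : B x -> vmax B y -> vmax B (x * y).
Proof. by rewrite -!vlt1 => Bx y1; apply: (vlt_le_trans y1); exists x. Qed.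
Lemma vmaxMr x y : vmax B x -> B y -> vmax B (x * y).
Proof. by rewrite mulrC => ? ?; apply: vmaxMl. Qed.
Lemma vmax_sum (I : Type) (r : seq I) (P : pred I) (E : I -> F) :
  (forall i, P i -> vmax B (E i)) -> vmax B (\sum_(i <- r | P i) E i).
Proof. by move=> BE; elim/big_ind: _ => //; [apply: vmax0 | apply: vmaxD]. Qed.
Lemma vmax1 : ~ vmax B 1. Proof. by rewrite -vlt1; apply; apply: vle_refl. Qed.
Lemma vmax_unit x : B x -> ~ vmax B x -> x != 0 /\ B x^-1.
Proof.
move=> Bx mx; case: (eqVneq x 0) mx => [->|x0 mx]; first by move=> /(_ vmax0).
by split=> //; apply: contrapT => nB; apply: mx; split=> //; right.
Qed.
Lemma vmax_unitN x : x != 0 -> B x^-1 -> ~ vmax B x.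
Proof. by move=> x0 Bx [_ [/eqP|//]]; apply/negP. Qed.
Lemma vmax_expr n x : B x -> vmax B (x ^+ n) -> vmax B x.
Proof.
move=> Bx mxn; apply: contrapT => /(vmax_unit Bx)[x0 Bx'].
by case: (vmax_unitN (expf_neq0 n x0) _ mxn); rewrite -exprVn; apply: vringX.
Qed.
Lemma vle_argmin n (E : 'I_n.+1 -> F) : exists i, forall j, vle (E i) (E j).
Proof.
elim: n E => [|n IHn] E.
  by exists ord0 => j; rewrite (ord1 j); apply: vle_refl.
have [i hi] := IHn (E \o lift ord0).
case: (vle_total (E ord0) (E (lift ord0 i))) => h.
  exists ord0 => j; case: (unliftP ord0 j) => [k ->|->]; last exact: vle_refl.
  exact: vle_trans h (hi k).
by exists (lift ord0 i) => j; case: (unliftP ord0 j) => [k ->|-> //]; apply: hi.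
Qed.
End ValuationOrder.

(** * Integral closure *)

Section IntegralClosure.
Variables (K : fieldType) (L : fieldExtType K) (A : K -> Prop).
Hypothesis valA : is_valuation_ring A.

(** Indexing the predicate by the proof that A is a valuation ring lets the subring instance be
    attached to it. A then becomes a ring type, and the theory of [integralOver] gives the closure
    properties of B. *)
Definition val_pred of is_valuation_ring A : {pred K} := fun x => `[< A x >].

Lemma val_pred_subring : subring_closed (val_pred valA).
Proof.
split=> [|x y|x y]; rewrite !unfold_in; first by apply/asboolP; apply: (vring1 valA).
  by move=> /asboolP Ax /asboolP Ay; apply/asboolP; apply: (vringB valA).
by move=> /asboolP Ax /asboolP Ay; apply/asboolP; apply: (vringM valA).
Qed.

HB.instance Definition _ :=
  GRing.isSubringClosed.Build K (val_pred valA) val_pred_subring.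

Definition val_subring := {x : K | x \in val_pred valA}.
HB.instance Definition _ := SubChoice.on val_subring.
HB.instance Definition _ := [SubChoice_isSubComNzRing of val_subring by <:].

Local Notation intA := (@int_closure K L A).
Let toL : {rmorphism val_subring -> L} := in_alg L \o (val : val_subring -> K).

Lemma int_closureP x : intA x <-> integralOver toL x.
Proof.
split=> [[f [fm Af fx]] | [q qm /rootP qx]]; last first.
  exists (map_poly val q); split.
  - exact: monic_map.
  - by move=> i; rewrite coef_map; apply/asboolP/(valP q`_i).
  - by rewrite -map_poly_comp.
pose q : {poly val_subring} := \poly_(i < size f) insubd 0 f`_i.
have qf : map_poly val q = f.
  apply/polyP=> i; rewrite coef_map coef_poly.
  case: ltnP => [_|lefi]; last by rewrite nth_default.
  by rewrite /= insubdK // unfold_in; apply/asboolP.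
exists q; last first.
  have e : map_poly toL q = map_poly (in_alg L) (map_poly val q) by exact: map_poly_comp.
  by apply/rootP; rewrite e qf.
have: val (lead_coef q) = 1 by rewrite -(monicP fm) -qf lead_coef_map_inj //; apply: val_inj.
by move=> h; apply/monicP/val_inj.
Qed.

Lemma int_alg a : A a -> intA a%:A.
Proof.
move=> Aa; have Pa : a \in val_pred valA by apply/asboolP.
by apply/int_closureP; have := integral_id toL (Sub a Pa : val_subring).
Qed.
Lemma int1 : intA 1. Proof. by apply/int_closureP; apply: integral1. Qed.
Lemma int0 : intA 0. Proof. by apply/int_closureP; apply: integral0. Qed.
Lemma intM x y : intA x -> intA y -> intA (x * y).
Proof. by rewrite !int_closureP; apply: integral_mul. Qed.
Lemma intB x y : intA x -> intA y -> intA (x - y).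
Proof. by rewrite !int_closureP; apply: integral_sub. Qed.
Lemma intD x y : intA x -> intA y -> intA (x + y).
Proof. by rewrite !int_closureP; apply: integral_add. Qed.
Lemma intN x : intA x -> intA (- x).
Proof. by rewrite !int_closureP; apply: integral_opp. Qed.
Lemma int_prod (I : Type) (r : seq I) (P : pred I) (E : I -> L) :
  (forall i, P i -> intA (E i)) -> intA (\prod_(i <- r | P i) E i).
Proof. by move=> BE; elim/big_ind: _ => //; [apply: int1 | apply: intM]. Qed.
Lemma int_sum (I : Type) (r : seq I) (P : pred I) (E : I -> L) :
  (forall i, P i -> intA (E i)) -> intA (\sum_(i <- r | P i) E i).
Proof. by move=> BE; elim/big_ind: _ => //; [apply: int0 | apply: intD]. Qed.
Lemma int_trans (q : {poly L}) u :
  q \is monic -> root q u -> (forall i, intA q`_i) -> intA u.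
Proof.
move=> qm qu qi; apply/int_closureP; apply: integral_root_monic qm qu _.
by apply/integral_poly => i; apply/int_closureP.
Qed.
(** A is integrally closed: if v(a) < 0, the leading term a^n has strictly smaller value than every
    other term of a monic relation. *)
Lemma int_algP a : intA a%:A -> A a.
Proof.
case=> f [fm Af]; rewrite horner_map => /eqP; rewrite fmorph_eq0 => /eqP fa.
apply: contrapT => nAa; have a0 : a != 0.
  by apply: contra_notN nAa => /eqP->; apply: vring0 valA.
have /(vltx1 A) a1 := nAa.
have fn0 : (0 < size f)%N by rewrite size_poly_gt0 monic_neq0.
have sf : size f = (size f).-1.+1 by rewrite prednK.
move: fa; rewrite horner_coef sf big_ord_recr /= -/(lead_coef f) (monicP fm) mul1r.
set n := (size f).-1 => fa.
have an0 : a ^+ n != 0 by rewrite expf_neq0.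
suff: vlt A (a ^+ n) (\sum_(i < n) f`_i * a ^+ i).
  have -> : \sum_(i < n) f`_i * a ^+ i = - a ^+ n by apply/eqP; rewrite -addr_eq0 fa.
  by apply; rewrite -{2}[_ ^+ n]opprK; apply/(vleN valA)/(vle_refl valA).
apply: (vlt_sum valA) => // i _; apply: (vlt_le_trans valA) (_ : vle A (a ^+ i) _); last by exists f`_i.
exact: vlt_exp2l.
Qed.
End IntegralClosure.

(** * Artin-Schreier extensions *)

Section AlgEmbedding.
Variables (K : fieldType) (L : fieldExtType K).
Implicit Types a b : K.
Lemma algL_inj : injective (fun a => a%:A : L).
Proof. exact: (fmorph_inj (in_alg L)). Qed.
Lemma algL_eq0 a : (a%:A == 0 :> L) = (a == 0).
Proof. exact: (fmorph_eq0 (in_alg L)). Qed.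
Lemma algLM a b : (a * b)%:A = a%:A * b%:A :> L.
Proof. exact: (rmorphM (in_alg L)). Qed.
Lemma algLB a b : (a - b)%:A = a%:A - b%:A :> L.
Proof. exact: (rmorphB (in_alg L)). Qed.
Lemma algLV a : (a^-1)%:A = (a%:A)^-1 :> L.
Proof. exact: (fmorphV (in_alg L)). Qed.
Lemma algLX a n : (a ^+ n)%:A = a%:A ^+ n :> L.
Proof. exact: (rmorphXn (in_alg L)). Qed.
Lemma algLMn a n : (a *+ n)%:A = a%:A *+ n :> L.
Proof. exact: (rmorphMn (in_alg L)). Qed.
End AlgEmbedding.

Section IteratedMorphism.
Variables (K : fieldType) (L : fieldExtType K) (f : {lrmorphism L -> L}).

(** Packaging the powers of f as morphisms allows [AS_aut] to be instantiated with a power of f, as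
    [quasi_idempotent] does. *)
Definition lriter n (x : L) := iter n f x.

Fact lriter_linear n : linear (lriter n).
Proof. by move=> a x y; elim: n => //= n; rewrite /lriter /= => ->; rewrite linearP. Qed.
HB.instance Definition _ n := GRing.isSemilinear.Build K L L _ (lriter n)
  (GRing.semilinear_linear (lriter_linear n)).

Fact lriter_monoid_morphism n : monoid_morphism (lriter n).
Proof.
by split=> [|x y]; elim: n => //= n; rewrite /lriter /= => ->; rewrite ?rmorph1 ?rmorphM.
Qed.
HB.instance Definition _ n :=
  GRing.isMonoidMorphism.Build L L (lriter n) (lriter_monoid_morphism n).

Lemma lriterD m n x : lriter (m + n) x = lriter m (lriter n x).
Proof. exact: iterD. Qed.
Lemma lriterS n x : lriter n.+1 x = f (lriter n x). Proof. by []. Qed.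
Lemma lriterM m n x : iter m (lriter n) x = lriter (m * n) x.
Proof. by elim: m => //= m ->; rewrite mulSn lriterD. Qed.
End IteratedMorphism.

Lemma natr_inj_pchar (F : fieldType) p i j : p \in [pchar F] ->
  (i < p)%N -> (j < p)%N -> i%:R = j%:R :> F -> i = j.
Proof.
move=> charF; wlog le_ij : i j / (i <= j)%N => [W ip jp e|ip jp e].
  by case: (leqP i j) => [/W|/ltnW/W Wji]; [apply | apply/esym/Wji].
have /eqP: (j - i)%:R = 0 :> F by rewrite natrB // e subrr.
rewrite -(dvdn_pcharf charF) => /dvdnP[[|k]] /eqP; rewrite ?mul0n ?subn_eq0.
  by move=> le_ji; apply/eqP; rewrite eqn_leq le_ij.
rewrite mulSn => /eqP e2; suff: (p < p)%N by rewrite ltnn.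
by apply: leq_ltn_trans (leq_addr (k * p) p) _; rewrite -e2 (leq_ltn_trans (leq_subr i j)).
Qed.

Lemma prod_rot (R : comNzRingType) (F : nat -> R) n :
  F n = F 0%N -> \prod_(i < n) F i.+1 = \prod_(i < n) F i.
Proof.
case: n => [|n] Fn; first by rewrite !big_ord0.
by rewrite big_ord_recr big_ord_recl /= Fn mulrC.
Qed.

(** The normalisation f alpha = alpha + 1 is always reached by [AS_aut_scale], and it survives the
    translations alpha - c of [AS_aut_shift]. *)
Record AS_aut (p : nat) (K : fieldType) (L : fieldExtType K)
  (f : {lrmorphism L -> L}) (alpha : L) (h : K) : Prop := ASAut {
  as_prime : prime p;
  as_pchar : p \in [pchar K];
  as_dim : \dim {:L} = p;
  as_gen : <<1%VS; alpha>>%VS = fullv;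
  as_eq : alpha ^+ p - alpha = h%:A;
  as_conj : f alpha = alpha + 1
}.

Section ArtinSchreier.
Variables (p : nat) (K : fieldType) (L : fieldExtType K).
Variables (f : {lrmorphism L -> L}) (alpha : L) (h : K).
Hypothesis asH : AS_aut p f alpha h.

Let p_pr := as_prime asH.
Let charK := as_pchar asH.
Let dimL := as_dim asH.
Let gen_alpha := as_gen asH.
Let eq_alpha := as_eq asH.
Let f_alpha := as_conj asH.

Local Notation mapL := (map_poly (in_alg L)).
Local Notation s := (lriter f).

Lemma charL : p \in [pchar L].
Proof. exact: (rmorph_pchar (in_alg L)). Qed.

Lemma natL_inj i j : (i < p)%N -> (j < p)%N -> i%:R = j%:R :> L -> i = j.
Proof. exact: (natr_inj_pchar charL). Qed.

Lemma s_alpha n : s n alpha = alpha + n%:R.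
Proof.
elim: n => [|n IHn]; first by rewrite addr0.
by rewrite lriterS IHn rmorphD rmorph_nat /= f_alpha -natr1 addrAC addrA.
Qed.

Lemma s_alg n a : s n a%:A = a%:A.
Proof. by rewrite linearZ /= rmorph1. Qed.

Lemma s_horner n (g : {poly K}) x : s n (mapL g).[x] = (mapL g).[s n x].
Proof.
rewrite -horner_map -map_poly_comp; congr _.[_]; apply: eq_map_poly => a /=.
exact: s_alg.
Qed.

Lemma alpha_repr y : exists2 g : {poly K}, (size g <= p)%N & y = (mapL g).[alpha].
Proof.
have /polyOver1P [g e] := Fadjoin_polyOver 1%AS alpha y.
exists g; last by rewrite -e Fadjoin_poly_eq // gen_alpha memvf.
rewrite -(size_map_poly (in_alg L)) -e (leq_trans (size_Fadjoin_poly _ _ _)) //.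
by rewrite adjoin_degreeE gen_alpha dimL dimv1 divn1.
Qed.

(** The p conjugates alpha + i are distinct. This count of roots does the work of Galois theory in
    [fixed_alg] and [conj_poly]. *)
Lemma poly_conj_eq0 (q : {poly L}) : (size q <= p)%N ->
  (forall i, (i < p)%N -> q.[alpha + i%:R] = 0) -> q = 0.
Proof.
move=> sq qi; apply/eqP; apply: contraTT sq => q0; rewrite -ltnNge.
have := @max_poly_roots _ q [seq alpha + i%:R | i <- iota 0 p] q0.
rewrite size_map size_iota; apply.
  by apply/allP => _ /mapP[i + ->]; rewrite mem_iota => /qi/rootP.
rewrite map_inj_in_uniq ?iota_uniq // => i j; rewrite !mem_iota => ip jp.
by move/addrI/natL_inj; apply.
Qed.

Lemma fixed_alg y : f y = y -> exists a, y = a%:A.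
Proof.
move=> fy; have [g sg e] := alpha_repr y.
have sy n : s n y = y by elim: n => // n IHn; rewrite lriterS IHn.
have: mapL g - y%:P = 0.
  apply: poly_conj_eq0 => [|i _]; last first.
    by rewrite hornerD hornerN hornerC -s_alpha -s_horner -e sy subrr.
  rewrite (leq_trans (size_polyD _ _)) // size_polyN geq_max size_map_poly sg.
  by rewrite (leq_trans (size_polyC_leq1 _)) ?prime_gt0.
move/eqP; rewrite subr_eq0 => /eqP/(congr1 (fun q : {poly L} => q`_0)).
by rewrite coef_map coefC /= => <-; exists g`_0.
Qed.

Lemma s_period y : s p y = y.
Proof.
have [g _ ->] := alpha_repr y.
by rewrite s_horner s_alpha (pcharf0 charL) addr0.
Qed.

Lemma alpha_notin a : alpha != a%:A.
Proof.
apply: contraNneq (oner_neq0 L) => e; have := s_alpha 1.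
by rewrite e s_alg -[X in X = _]addr0 => /addrI/esym/eqP.
Qed.

Definition cnorm y := \prod_(i < p) s i y.

Lemma f_cnorm y : f (cnorm y) = cnorm y.
Proof.
rewrite /cnorm rmorph_prod /=.
by rewrite (prod_rot (F := fun i => s i y)) // s_period.
Qed.

Lemma cnorm_alg y : exists a, cnorm y = a%:A.
Proof. exact: fixed_alg (f_cnorm y). Qed.

Lemma cnormM y z : cnorm (y * z) = cnorm y * cnorm z.
Proof. by rewrite -big_split; apply: eq_bigr => i _; rewrite rmorphM. Qed.

Lemma cnorm_eq0 y : (cnorm y == 0) = (y == 0).
Proof.
rewrite prodf_seq_eq0; apply/hasP/eqP => [[i _]|->]; first by rewrite fmorph_eq0 => /eqP.
by exists (Ordinal (prime_gt0 p_pr)); rewrite ?mem_index_enum ?rmorph0 /=.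
Qed.

Lemma conj_poly : \prod_(i < p) ('X - (alpha + i%:R)%:P) = 'X^p - 'X - (h%:A)%:P.
Proof.
have p1 := prime_gt1 p_pr; have p0 := prime_gt0 p_pr.
have sX : size ('X + (h%:A)%:P : {poly L}) = 2 by rewrite size_polyDl ?size_polyX // ltnS size_polyC_leq1.
have mon : 'X^p - ('X + (h%:A)%:P) \is @monic L.
  by rewrite monicE lead_coefDl ?lead_coefXn // size_polyN sX size_polyXn.
rewrite -addrA -opprD; apply/eqP; rewrite -subr_eq0; apply/eqP.
apply: poly_conj_eq0.
  (* Both polynomials are monic of degree p, so their difference has degree below p and
     [poly_conj_eq0] applies. *)
  have sz : size (\prod_(i < p) ('X - (alpha + i%:R)%:P)) = p.+1.
    by rewrite size_prod_XsubC /index_enum -enumT size_enum_ord.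
  have sz2 : size ('X^p - ('X + (h%:A)%:P) : {poly L}) = p.+1.
    by rewrite size_polyDl ?size_polyXn // size_polyN sX.
  apply/leq_sizeP => j; rewrite leq_eqVlt => /orP[/eqP<-|lt].
    rewrite coefB; move/monicP: mon.
    have := monic_prod_XsubC (index_enum 'I_p) xpredT (fun i : 'I_p => alpha + i%:R).
    move=> /monicP + +.
    by rewrite !lead_coefE sz sz2 /= => -> ->; rewrite subrr.
  by rewrite nth_default // (leq_trans (size_polyD _ _)) // size_polyN sz sz2 maxnn.
move=> i ip; rewrite hornerD hornerN horner_prod (bigD1 (Ordinal ip)) //= hornerXsubC subrr mul0r sub0r.
rewrite !hornerE -s_alpha -(s_alg i h) -eq_alpha rmorphB rmorphXn /=; ring.
Qed.

Lemma cnorm_alpha : cnorm alpha = h%:A.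
Proof.
have: (\prod_(i < p) ('X - (alpha + i%:R)%:P)).[0] = - h%:A.
  by rewrite conj_poly !hornerE expr0n eqn0Ngt prime_gt0 // sub0r oppr0 sub0r.
rewrite horner_prod (eq_bigr (fun i : 'I_p => - s i alpha)) => [|i _]; last first.
  by rewrite hornerXsubC s_alpha sub0r.
rewrite prodrN card_ord => e; apply: (mulfI (_ : (-1) ^+ p != 0 :> L)).
  by rewrite signr_eq0.
rewrite /cnorm e -[LHS]mulN1r; congr (_ * _).
(* For p = 2 the sign (-1)^p is 1, which equals -1 in characteristic 2. *)
have [p2|op] := even_prime p_pr; last by rewrite -signr_odd op expr1.
move: charL; rewrite p2 sqrrN expr1n => /pcharf0 c2.
by apply/esym/eqP; rewrite -subr_eq0 opprK; apply/eqP.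
Qed.

(** The matrix E of conjugates of the basis diagonalises multiplication by y, with the conjugates of
    y as eigenvalues. E is invertible because the Vandermonde matrix of the distinct alpha + i
    factors through it. *)
Lemma normLKE y : (normLK y)%:A = cnorm y :> L.
Proof.
rewrite /normLK; set M := passmx.mxof _ _ _.
set e := vbasis fullv in M *.
have e_basis : basis_of fullv e by apply: vbasisP.
pose n := \dim {:L}; have np : n = p by [].
pose E : 'M[L]_n := \matrix_(k, i) s i e`_k.
have eM (k : 'I_n) : e`_k * y = \sum_j M k j *: e`_j.
  have := passmx.mul_mxof e e (amulr y) (delta_mx 0 k).
  rewrite passmx.vecof_delta lfunE /= => /(congr1 (passmx.vecof e)).
  rewrite passmx.rVofK // => <-; rewrite -rowE /passmx.vecof.
  by apply: eq_bigr => j _; rewrite mxE.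
have ME : map_mx (in_alg L) M *m E = E *m diag_mx (\row_i s i y).
  apply/matrixP => k i; rewrite mul_mx_diag !mxE -rmorphM eM rmorph_sum.
  by apply: eq_bigr => j _; rewrite !mxE [RHS]linearZ /= mulr_algl.
have detE : \det E != 0.
  pose v : 'rV[L]_n := \row_i (alpha + i%:R).
  pose Q : 'M[L]_n := \matrix_(k, j) (coord e j (alpha ^+ k))%:A.
  have QE : Q *m E = Vandermonde n v.
    apply/matrixP => k i; rewrite !mxE -s_alpha -rmorphXn /=.
    rewrite [alpha ^+ k](coord_basis e_basis) ?memvf // rmorph_sum.
    by apply: eq_bigr => j _; rewrite !mxE [RHS]linearZ /= mulr_algl.
  have : \det (Vandermonde n v) != 0.
    rewrite det_Vandermonde; apply/prodf_neq0 => i _; apply/prodf_neq0 => j ij.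
    rewrite !mxE opprD addrACA subrr add0r subr_eq0; apply: contraTneq ij.
    by move/natL_inj => -> //; rewrite ?ltnn // -np.
  by rewrite -QE det_mulmx; apply: contraNneq => ->; rewrite mulr0.
have := congr1 (fun X : 'M_n => \det X) ME.
rewrite !det_mulmx mulrC => /(mulfI detE).
rewrite det_map_mx det_diag /= -/n -/M => detM; rewrite -/M detM /cnorm -np.
by apply: eq_bigr => i _; rewrite mxE.
Qed.
End ArtinSchreier.

Lemma natL_exp (K : fieldType) p n : p \in [pchar K] -> n%:R ^+ p = n%:R :> K.
Proof. by move=> charK; rewrite -(pFrobenius_autE charK) pFrobenius_aut_nat. Qed.

Lemma AS_aut_scale (p : nat) (K : fieldType) (L : fieldExtType K)
  (g : {lrmorphism L -> L}) (alpha : L) (h : K) n :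
  prime p -> p \in [pchar K] -> \dim {:L} = p -> <<1%VS; alpha>>%VS = fullv ->
  alpha ^+ p - alpha = h%:A -> g alpha = alpha + n%:R -> ~~ (p %| n)%N ->
  AS_aut p g (n%:R^-1 *: alpha) (h / n%:R).
Proof.
move=> p_pr charK dimL gen eqa ga pn.
have n0 : n%:R != 0 :> K by rewrite -(dvdn_pcharf charK).
split=> //.
- apply/eqP; rewrite eqEsubv subvf -gen; apply/FadjoinP; split; first exact: subv_adjoin.
  have e : alpha = n%:R *: (n%:R^-1 *: alpha) by rewrite scalerA divff // scale1r.
  by rewrite [X in X \in _]e memvZ // memv_adjoin.
- rewrite exprZn exprVn natL_exp // -scalerBr eqa scalerA mulrC //.
- rewrite linearZ /= ga scalerDr; congr (_ + _).
  by rewrite -(scaler_nat n (1 : L)) scalerA mulVf // scale1r.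
Qed.

Lemma AS_aut_shift (p : nat) (K : fieldType) (L : fieldExtType K)
  (f : {lrmorphism L -> L}) (alpha : L) (h c : K) :
  AS_aut p f alpha h -> AS_aut p f (alpha - c%:A) (h - (c ^+ p - c)).
Proof.
case=> p_pr charK dimL gen eqa fa; split=> //.
- apply/eqP; rewrite eqEsubv subvf -gen; apply/FadjoinP; split; first exact: subv_adjoin.
  rewrite -{1}[alpha](subrK c%:A) memvD ?memv_adjoin // memvZ //.
  by apply: (subvP (subv_adjoin _ _)); apply: mem1v.
- have cL : p \in [pchar L] := rmorph_pchar (in_alg L) charK.
  rewrite -(pFrobenius_autE cL) pFrobenius_autB_comm ?pFrobenius_autE; last exact: mulrC.
  by rewrite !algLB algLX -eqa; ring.
- by rewrite rmorphB /= linearZ /= rmorph1 fa addrAC.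
Qed.

(** * The integral closure over a Henselian ring is local *)

Section HenselianLocal.
Variables (p : nat) (K : fieldType) (L : fieldExtType K) (A : K -> Prop).
Hypotheses (valA : is_valuation_ring A) (henA : henselian A).
Variables (f : {lrmorphism L -> L}) (alpha : L) (h : K).
Hypothesis asH : AS_aut p f alpha h.
Let p_pr := as_prime asH.

Local Notation mapL := (map_poly (in_alg L)).
Local Notation s := (lriter f).
Local Notation B := (@int_closure K L A).
Local Notation N := (@normLK K L).
Local Notation NE := (normLKE asH).

Lemma int_lriter n x : B x -> B (s n x).
Proof.
move=> [g [gm Ag gx]]; exists g; split=> //.
by rewrite -s_horner gx rmorph0.
Qed.

Lemma normLKM x y : N (x * y) = N x * N y.
Proof.
by apply: (@algL_inj _ L); rewrite algLM !NE cnormM.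
Qed.

Lemma normLK1 : N 1 = 1.
Proof.
apply: (@algL_inj _ L); rewrite NE scale1r /cnorm big1 // => i _.
by rewrite rmorph1.
Qed.

Lemma normLK_alg a : N a%:A = a ^+ p.
Proof.
apply: (@algL_inj _ L); rewrite NE algLX /cnorm -[in RHS](card_ord p) -prodr_const.
by apply: eq_bigr => i _; rewrite s_alg.
Qed.

Lemma normLK_eq0 x : (N x == 0) = (x == 0).
Proof. by rewrite -(cnorm_eq0 asH) -NE algL_eq0. Qed.

Lemma normLKV x : N x^-1 = (N x)^-1.
Proof.
have [->|x0] := eqVneq x 0.
  by have/eqP e: N 0 == 0; rewrite ?normLK_eq0 // invr0 e invr0.
by apply: (mulfI (_ : N x != 0)); rewrite ?normLK_eq0 // -normLKM !divff ?normLK1 // normLK_eq0.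
Qed.

Lemma normLK_int x : B x -> A (N x).
Proof.
move=> Bx; apply: (int_algP valA (L := L)); rewrite NE.
by apply: (int_prod valA) => i _; apply: int_lriter.
Qed.

Lemma normLK_unit x : B x -> ~ vmax A (N x) -> x != 0 /\ B x^-1.
Proof.
move=> Bx /(vmax_unit valA (normLK_int Bx)) [N0 AN].
have x0 : x != 0 by rewrite -normLK_eq0.
split=> //; have p0 := prime_gt0 p_pr.
have -> : x^-1 = (N x)^-1%:A * \prod_(i < p | i != Ordinal p0) s i x.
  apply: (mulfI x0); rewrite divff // mulrCA -(_ : cnorm p f x = x * _); last first.
    by rewrite /cnorm (bigD1 (Ordinal p0)).
  by rewrite -NE -algLM mulVf ?scale1r.
apply: (intM valA); first exact: int_alg.
by apply: (int_prod valA) => i _; apply: int_lriter.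
Qed.

(* The Jacobson radical of B: by normLK_unit, an element of B is a unit when its norm
   is a unit of A. *)
Definition jac x := B x /\ forall y, B y -> ~ vmax A (N (1 - x * y)).

Lemma jacMr x y : jac x -> B y -> jac (x * y).
Proof.
move=> [Bx Jx] By; split=> [|z Bz]; first exact: intM.
by rewrite -mulrA; apply/Jx/(intM valA).
Qed.

Lemma jacD x y : jac x -> jac y -> jac (x + y).
Proof.
move=> [Bx Jx] [By Jy]; split=> [|z Bz]; first exact: intD.
have Bu : B (1 - x * z) by apply: (intB valA); [apply: int1 | apply: intM].
have [u0 Bu'] := normLK_unit Bu (Jx z Bz).
(* Since 1 - x z is a unit of B, the radical condition on y can be applied with z / (1 - x z). *)
have -> : 1 - (x + y) * z = (1 - x * z) * (1 - y * (z * (1 - x * z)^-1)).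
  by field.
rewrite normLKM => mx; have Bz' : B (z * (1 - x * z)^-1) by apply: intM.
have Bv : B (1 - y * (z * (1 - x * z)^-1)).
  by apply: (intB valA); [apply: int1 | apply: intM].
have [v0 Av] := vmax_unit valA (normLK_int Bv) (Jy _ Bz').
have [w0 Aw] := vmax_unit valA (normLK_int Bu) (Jx _ Bz).
by apply: vmax_unitN mx; rewrite ?mulf_neq0 // invfM; apply: vringM.
Qed.

Lemma lriter_mulp n x : s (n * p) x = x.
Proof.
rewrite -lriterM; elim: n => //= n ->.
exact: (s_period asH).
Qed.

Lemma lriter_surj n x : exists m, x = s n (s m x).
Proof.
exists (n * p - n)%N; rewrite -lriterD subnKC ?lriter_mulp //.
by rewrite leq_pmulr ?prime_gt0.
Qed.

Lemma normLK_lriter n x : N (s n x) = N x.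
Proof.
elim: n => // n <-; apply: (@algL_inj _ L); rewrite !NE lriterS -[RHS](f_cnorm asH).
by rewrite rmorph_prod; apply: eq_bigr => i _; rewrite /= -!iterS /lriter -iterSr.
Qed.

Lemma jac_lriter n x : jac x -> jac (s n x).
Proof.
move=> [Bx Jx]; split=> [|y By]; first exact: int_lriter.
have [m ->] := lriter_surj n y.
rewrite -rmorphM -(rmorph1 (s n)) -rmorphB normLK_lriter.
exact/Jx/int_lriter.
Qed.

(** The product of the conjugates of 1 - a y has the form 1 - a t with t in B. For nonzero a, t lies
    in K, hence in A, and the norm is 1 modulo the maximal ideal. *)
Lemma jac_vmax a : vmax A a -> jac a%:A.
Proof.
move=> ma; have Aa := vmaxB ma; split=> [|y By]; first exact: int_alg.
have [t Bt e] : exists2 t, B t & cnorm p f (1 - a%:A * y) = 1 - a%:A * t.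
  rewrite /cnorm; elim/big_ind: _ => [|u v [t Bt ->] [r Br ->]|i _].
  - by exists 0; [apply: int0 | rewrite mulr0 subr0].
  - exists (t + r - a%:A * (t * r)); last by ring.
    apply: (intB valA); first exact: intD.
    by apply: (intM valA); [apply: int_alg | apply: intM].
  - by exists (s i y); [apply: int_lriter | rewrite rmorphB rmorph1 rmorphM /= s_alg].
have [a0|a0] := eqVneq a 0.
  by rewrite a0 scale0r mul0r subr0 normLK1; apply: vmax1.
have At : A ((1 - N (1 - a%:A * y)) / a).
  apply: (int_algP valA (L := L)).
  rewrite algLM algLB algLV scale1r NE e.
  by rewrite opprB addrC subrK mulrC mulKf ?algL_eq0.
move=> mN; have := vmaxD valA mN (vmaxMl valA At ma).
by rewrite divfK // addrC subrK; apply: vmax1.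
Qed.

Lemma jac_alg a : jac a%:A -> vmax A a.
Proof.
move=> [Ba Ja]; have Aa := int_algP valA Ba.
apply: contrapT => /(vmax_unit valA Aa) [a0 Aa'].
apply: (Ja (a^-1)%:A); first exact: int_alg.
rewrite -algLM divff // scale1r subrr.
by have/eqP->: N 0 == 0; [rewrite normLK_eq0 | apply: vmax0].
Qed.

(* For each j in turn, z is replaced by a longest non-radical product
   z * s j z * s (2 j) z * ...; the product of all p conjugates is a norm in the
   maximal ideal of A, hence radical. *)
Lemma quasi_idempotent x k : B x -> vmax A (N x) -> ~ jac x -> (k < p)%N ->
  exists y, [/\ B y, ~ jac (x * y) &
    forall j, (0 < j <= k)%N -> jac (x * y * s j (x * y))].
Proof.
move=> Bx mx nJx; elim: k => [_|k IHk kp].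
  exists 1; split; [exact: int1 | by rewrite mulr1 | ].
  by move=> j /andP[j0]; rewrite leqNgt j0.
have [y [By nJ Js]] := IHk (ltnW kp); set z := x * y in nJ Js.
have Bz : B z by apply: intM.
pose F m := \prod_(i < m) s (i * k.+1) z.
have BF m : B (F m) by apply: (int_prod valA) => i _; apply: int_lriter.
have JFp : jac (F p).
  (* As 0 < k + 1 < p, the power f^(k+1) also generates the group, and [F p] is the norm of z
     computed with it. *)
  have asH' : AS_aut p (lriter f k.+1) (k.+1%:R^-1 *: alpha) (h / k.+1%:R).
    apply: AS_aut_scale (as_prime asH) (as_pchar asH) (as_dim asH) (as_gen asH) (as_eq asH) _ _.
      exact: (s_alpha asH).
    by rewrite gtnNdvd.
  have FE : F p = cnorm p (lriter f k.+1) z.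
    by apply: eq_bigr => i _; rewrite -lriterM.
  have [a aE] := cnorm_alg asH' z; rewrite FE aE; apply: jac_vmax.
  have Aa : A a by apply: (int_algP valA (L := L)); rewrite -aE -FE.
  (* The norm of a is a^p, and it has N z as a factor, which is in the maximal ideal because N x
     is. *)
  apply: (vmax_expr valA (n := p) Aa); rewrite -normLK_alg -aE -FE /F.
  rewrite -(prednK (prime_gt0 p_pr)) big_ord_recl mul0n -mulrA normLKM.
  apply: (vmaxMr valA) => //; apply: normLK_int; apply: (intM valA) => //.
  by apply: (int_prod valA) => i _; apply: int_lriter.
have [m nJm JSm] : exists2 m, ~ jac (F m.+1) & jac (F m.+2).
  apply: contrapT => nex; suff nJF m : ~ jac (F m.+1).
    by apply: (nJF p.-1); rewrite prednK ?prime_gt0.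
  elim: m => [|m IHm]; first by rewrite /F big_ord1 mul0n.
  by move=> Jm; apply: nex; exists m.
pose w := \prod_(i < m) s (i.+1 * k.+1) z.
have FE : F m.+1 = x * (y * w).
  by rewrite /F big_ord_recl mul0n mulrA.
have Bw : B w by apply: (int_prod valA) => i _; apply: int_lriter.
exists (y * w); split=> [||j jk]; first exact: intM.
  by rewrite -FE.
case/andP: jk => j0; rewrite leq_eqVlt ltnS => /orP[/eqP->|jk].
  (* For the new index j = k + 1, the shifted product contains the factor that completes [F m.+1] to
     [F m.+2]; smaller j are covered by the induction. *)
  rewrite -FE.
  have -> : s k.+1 (F m.+1) = w * s (m.+1 * k.+1) z.
    transitivity (\prod_(i < m.+1) s (i.+1 * k.+1) z); last by rewrite big_ord_recr.
    by rewrite rmorph_prod; apply: eq_bigr => i _; rewrite mulSn lriterD.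
  rewrite mulrA mulrAC; apply: jacMr => //.
  by have := JSm; rewrite /F big_ord_recr.
rewrite !mulrA -/z rmorphM mulrACA; apply: jacMr; first by apply: Js; rewrite j0.
by apply: (intM valA); last exact: int_lriter.
Qed.

(** When pairwise products are radical, all elementary symmetric functions after the first are
    radical, so q is X^n - S X^(n-1) modulo the radical. The two values are those of this polynomial
    and its derivative at 1. *)
Lemma horner_prod_XsubC_jac (r : seq L) : (forall x, x \in r -> B x) ->
  pairwise (fun x y => `[< jac (x * y) >]) r ->
  let q := \prod_(x <- r) ('X - x%:P) in let S := \sum_(x <- r) x in
  jac (q.[1] - (1 - S)) /\ jac (q^`().[1] - ((size r)%:R - ((size r)%:R - 1) * S)).
Proof.
have J0 : jac 0 by rewrite -(scale0r (1 : L)); apply/jac_vmax/(vmax0 valA).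
elim: r => [|x r IHr] Br /=.
  by rewrite !big_nil -polyC1 derivC !hornerC !(subr0, mulr0) subrr.
move=> /andP[/allP xr pr].
have [|J1 J2] := IHr _ pr; first by move=> y yr; apply: Br; rewrite inE yr orbT.
have Bx : B x by apply: Br; rewrite mem_head.
rewrite !big_cons; set q := (\prod_(y <- r) _) in J1 J2 *.
set S := \sum_(y <- r) y in J1 J2 *.
have JxS : jac (x * S).
  rewrite /S mulr_sumr big_seq; elim/big_ind: _ => //; first exact: jacD.
  by move=> y /xr/asboolP.
have B1x : B (1 - x) by apply: (intB valA); first exact: int1.
have Bn : B (size r)%:R.
  by rewrite -(rmorph_nat (in_alg L)); apply: (int_alg L valA); apply: (vring_nat valA).
rewrite derivM derivXsubC mul1r !hornerE -natr1; set n := (size r)%:R in Bn J2 *.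
split.
  have -> : (1 - x) * q.[1] - (1 - (x + S)) = (q.[1] - (1 - S)) * (1 - x) + x * S by ring.
  by apply: jacD JxS; apply: jacMr.
have -> : q.[1] + (1 - x) * q^`().[1] - (n + 1 - (n + 1 - 1) * (x + S)) =
   (q.[1] - (1 - S)) + (q^`().[1] - (n - (n - 1) * S)) * (1 - x) + x * S * (n - 1) by ring.
apply: jacD; last by apply: jacMr => //; apply: (intB valA); last exact: int1.
by apply: jacD => //; apply: jacMr.
Qed.

Lemma conj_prod_poly e :
  exists2 P : {poly K}, P \is monic & map_poly (in_alg L) P = \prod_(i < p) ('X - (s i e)%:P).
Proof.
set q := \prod_(i < p) _.
have fq : map_poly f q = q.
  rewrite /q rmorph_prod /= -(prod_rot (F := fun i => 'X - (s i e)%:P)).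
    by apply: eq_bigr => i _; rewrite rmorphB /= map_polyX map_polyC.
  by rewrite (s_period asH).
have/polyOver1P [P PE] : q \is a polyOver 1%VS.
  apply/polyOverP => i; have [|a ->] := fixed_alg asH (y := q`_i); last by rewrite memvZ ?mem1v.
  by rewrite -[in RHS]fq coef_map.
exists P => //; rewrite -(map_monic (in_alg L)) -PE; exact: monic_prod_XsubC.
Qed.

(* If x and 1 - x were both non-units, a suitable e in x B would have pairwise orthogonal
   conjugates modulo the radical and 1 - e non-unit.  Its characteristic polynomial is then
   X^p - X^(p-1) modulo the maximal ideal, and Hensel's lemma at 1 puts e in K. *)
Lemma int_closure_local x : B x -> vmax A (N x) -> vmax A (N (1 - x)) -> False.
Proof.
move=> Bx mx m1x; have p1 := prime_gt1 p_pr.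
have nJx : ~ jac x by move=> [_ /(_ 1 (int1 L valA))]; rewrite mulr1.
have pp : (p.-1 < p)%N by rewrite ltn_predL prime_gt0.
have [y [By nJ Js]] := quasi_idempotent Bx mx nJx pp.
have [t Bt mt] : exists2 t, B t & vmax A (N (1 - x * y * t)).
  apply: contrapT => nex; apply: nJ; split=> [|t Bt mt]; first exact: intM.
  by apply: nex; exists t.
set e := x * y * t in mt; have Be : B e by do 2?apply: intM.
have Je j : (0 < j < p)%N -> jac (e * s j e).
  move=> jp; rewrite /e rmorphM mulrACA; apply: jacMr.
    by case/andP: jp => j0 jp; apply: Js; rewrite j0 -ltnS prednK // ltnW.
  by apply: (intM valA); last exact: int_lriter.
have [P Pm PE] := conj_prod_poly e.
pose r := [seq s i e | i <- iota 0 p].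
have PEr : map_poly (in_alg L) P = \prod_(x <- r) ('X - x%:P).
  by rewrite PE big_map -(big_mkord xpredT (fun i => 'X - (s i e)%:P)) /index_iota subn0.
have Br z : z \in r -> B z by move=> /mapP[i _ ->]; apply: int_lriter.
have pr : pairwise (fun x y => `[< jac (x * y) >]) r.
  apply/(pairwiseP 0) => i j; rewrite !inE size_map size_iota => ip jp ij.
  rewrite !(nth_map 0%N) ?size_iota // !nth_iota // !add0n; apply/asboolP.
  rewrite -(subnKC (ltnW ij)) lriterD -rmorphM; apply/jac_lriter/Je.
  by rewrite subn_gt0 ij (leq_ltn_trans (leq_subr _ _)).
have [J1 J2] := horner_prod_XsubC_jac Br pr.
have AP i : A P`_i.
  apply: (int_algP valA (L := L)); rewrite -[_%:A](coef_map (in_alg L)) PEr.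
  have BX (q : {poly L}) : q \in [seq 'X - x%:P | x <- r] -> forall j, B q`_j.
    move=> /mapP[z /Br Bz ->] j; rewrite coefB coefX coefC; apply: (intB valA).
      by case: eqP => _; [apply: int1 | apply: int0].
    by case: eqP => _ //; apply: int0.
  rewrite -(big_map (fun x : L => 'X - x%:P) xpredT id) big_seq.
  elim/big_ind: _ i => [j|u v Bu Bv j|q qr j]; last exact: BX.
    by rewrite coef1; case: eqP => _; [apply: int1 | apply: int0].
  by rewrite coefM; apply: (int_sum valA) => k _; apply: (intM valA).
have P1 : P.[1]%:A = cnorm p f (1 - e).
  rewrite -[LHS](horner_map (in_alg L)) /= scale1r PE horner_prod.
  by apply: eq_bigr => i _; rewrite hornerXsubC rmorphB rmorph1.
have mP1 : vmax A P.[1].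
  by have := mt; rewrite -(_ : P.[1] = N (1 - e)) //; apply: (@algL_inj _ L); rewrite P1 NE.
(* Here n = p is 0 in L, so P(1) and P'(1) are 1 - S and S modulo the radical; their sum is 1, hence
   they are not both in the maximal ideal. *)
have mdP : ~ vmax A P^`().[1].
  move=> mdP; have := jacD J1 J2.
  rewrite -PEr size_map size_iota (pcharf0 (charL asH)).
  have h1 (Q : {poly K}) : (map_poly (in_alg L) Q).[1] = Q.[1]%:A.
    by have := horner_map (in_alg L) Q 1; rewrite rmorph1.
  rewrite deriv_map !h1.
  set S := \sum_(x <- r) x; have -> : P.[1]%:A - (1 - S) + (P^`().[1]%:A - (0 - (0 - 1) * S))
     = (P.[1] - (1 - P^`().[1]))%:A :> L by rewrite !algLB scale1r; ring.
  move=> /jac_alg mJ; have := vmaxD valA (vmaxBB valA mP1 mJ) mdP.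
  by rewrite opprB addrCA subrr addr0 subrK; apply: vmax1.
have [b [Ab rb mb]] := henA Pm AP (vring1 valA) mP1 mdP.
(* The root b is a conjugate of e and is fixed by f, so e itself equals b. *)
have eb : e = b%:A.
  have: root (map_poly (in_alg L) P) b%:A by rewrite rmorph_root.
  rewrite PEr root_prod_XsubC => /mapP[i _ bi].
  have [j ->] := lriter_surj i e.
  by rewrite -lriterD addnC lriterD -bi s_alg.
(* Now e times its first conjugate is b^2. Being radical, it forces b into the maximal ideal, while
   b is 1 residually. *)
have: jac (b ^+ 2)%:A.
  by have := Je 1%N; rewrite p1 eb s_alg -algLM; apply.
move=> /jac_alg /(vmax_expr valA Ab) mb'.
by have := vmaxBB valA mb' mb; rewrite opprB addrC subrK; apply: vmax1.
Qed.
End HenselianLocal.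

(** * The integral closure is a valuation ring *)

Section IntegralClosureValuation.
Variables (p : nat) (K : fieldType) (L : fieldExtType K) (A : K -> Prop).
Hypotheses (valA : is_valuation_ring A) (henA : henselian A).
Variables (f : {lrmorphism L -> L}) (alpha : L) (h : K).
Hypothesis asH : AS_aut p f alpha h.
Local Notation B := (@int_closure K L A).
Local Notation N := (@normLK K L).

Let unitB (x : L) := [/\ B x, x != 0 & B x^-1].

(** Dividing by the unit x + y reduces to two elements of sum 1, whose norms cannot both lie in the
    maximal ideal by [int_closure_local]. *)
Lemma int_closure_addr_unit x y : B x -> B y -> unitB (x + y) -> unitB x \/ unitB y.
Proof.
move=> Bx By [Bw w0 Bw']; set w := x + y in Bw w0 Bw'.
have Bx' : B (x / w) by apply: intM.
have By' : B (y / w) by apply: intM.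
have unitM z : B z -> ~ vmax A (N (z / w)) -> unitB z.
  move=> Bz nm; have [|z0 Bz'] := normLK_unit valA asH _ nm; first exact: intM.
  split=> //; first by apply: contraNneq z0 => ->; rewrite mul0r.
  have -> : z^-1 = (z / w)^-1 * w^-1 by rewrite invf_div mulrAC divff // mul1r.
  exact: intM.
have [mx|/unitM] := EM (vmax A (N (x / w))); last by left; auto.
have [my|/unitM] := EM (vmax A (N (y / w))); last by right; auto.
exfalso; apply: (int_closure_local valA henA asH Bx' mx).
by rewrite -(divff w0) -mulrBl /w addrC addKr.
Qed.

(* Multiplying the relation by a power of its leading coefficient c makes c x
   integral, so the leading term can be absorbed unless c x is a unit. *)
Lemma int_closure_val_rel x n (c : nat -> L) : x != 0 -> (forall i, B (c i)) ->
  \sum_(i < n.+1) c i * x ^+ i = 0 -> (exists2 i, (i <= n)%N & unitB (c i)) ->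
  B x \/ B x^-1.
Proof.
move=> x0; elim: n c => [|n IHn] c Bc.
  rewrite big_ord1 expr0 mulr1 => c0 [i]; rewrite leqn0 => /eqP-> [_].
  by rewrite c0 eqxx.
rewrite big_ord_recr /= => rel [i0 i0n Ui0].
have [[_ c0 Bc']|nU] := EM (unitB (c n.+1)).
  left; pose q := 'X^(n.+1) + \poly_(i < n.+1) (c i / c n.+1).
  have sq : (size (\poly_(i < n.+1) (c i / c n.+1))%R < size ('X^(n.+1) : {poly L}))%N.
    by rewrite size_polyXn ltnS size_poly.
  apply: (int_trans valA (q := q)).
  - by rewrite monicE lead_coefDl // lead_coefXn.
  - apply/rootP; rewrite hornerD hornerXn horner_poly.
    apply: (mulfI c0); rewrite mulr0 mulrDr -{}[RHS]rel addrC mulr_sumr; congr (_ + _).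
    by apply: eq_bigr => i _; rewrite mulrA mulrCA divff // mulr1.
  - move=> i; rewrite coefD coefXn coef_poly; apply: intD => //.
      by case: eqP => _; [apply: int1 | apply: int0].
    by case: ifP => _; [apply: intM | apply: int0].
set y := c n.+1 * x.
have By : B y.
  pose q := 'X^(n.+1) + \poly_(i < n.+1) (c i * c n.+1 ^+ (n - i)).
  have BX m : B (c n.+1 ^+ m).
    by elim: m => [|m IH]; [apply: int1 | rewrite exprS; apply: intM].
  have sq : (size (\poly_(i < n.+1) (c i * c n.+1 ^+ (n - i)))%R < size ('X^(n.+1) : {poly L}))%N.
    by rewrite size_polyXn ltnS size_poly.
  apply: (int_trans valA (q := q)).
  - by rewrite monicE lead_coefDl // lead_coefXn.
  - apply/rootP; rewrite hornerD hornerXn horner_poly addrC.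
    transitivity (c n.+1 ^+ n * (\sum_(i < n.+1) c i * x ^+ i + c n.+1 * x ^+ n.+1)).
      rewrite mulrDr.
      congr (_ + _); last by rewrite /y exprMn exprSr mulrA.
      rewrite mulr_sumr; apply: eq_bigr => i _; rewrite exprMn.
      have -> : c n.+1 ^+ n = c n.+1 ^+ (n - i) * c n.+1 ^+ i.
        by rewrite -exprD subnK // -ltnS.
      by ring.
    by rewrite rel mulr0.
  - move=> i; rewrite coefD coefXn coef_poly; apply: intD => //.
      by case: eqP => _; [apply: int1 | apply: int0].
    by case: ifP => _; [apply: intM | apply: int0].
(* The integral element y = c_(n+1) x lets the leading term be written y x^n and merged with the
   term of degree n. *)
pose c' i := if i == n then c n + y else c i.
have rel' : \sum_(i < n.+1) c' i * x ^+ i = 0.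
  rewrite -[RHS]rel big_ord_recr [in RHS]big_ord_recr /= {2}/c' eqxx mulrDl -addrA.
  congr (_ + (_ + _)); last by rewrite /y exprS mulrA.
  by apply: eq_bigr => i _; rewrite /c' ltn_eqF.
have Bc' i : B (c' i) by rewrite /c'; case: eqP => // _; apply: intD.
have [[i i_n Ui]|nex] := EM (exists2 i, (i < n)%N & unitB (c i)).
  by apply: (IHn c') => //; exists i; rewrite 1?ltnW // /c' ltn_eqF.
have [Ub|nUb] := EM (unitB (c n + y)).
  by apply: (IHn c') => //; exists n; rewrite // /c' eqxx.
(* The only unit coefficient left is c n, while c n + y is not a unit. Locality then makes y a unit,
   and 1/x = c_(n+1) / y is integral. *)
have Ucn : unitB (c n + y + - y).
  rewrite addrK; have <- // : i0 = n; move: i0n; rewrite leq_eqVlt ltnS => /orP[/eqP e|].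
    by case: nU; rewrite -e.
  by rewrite leq_eqVlt => /orP[/eqP //|lt]; case: nex; exists i0.
have [//||//|[_ _ BNy']] := int_closure_addr_unit _ _ Ucn; [exact: intD|exact: intN|].
right; have c0 : c n.+1 != 0.
  apply/eqP => c0; move: (Ucn); rewrite addrK => Un; apply: nUb.
  by rewrite /y c0 mul0r addr0.
have -> : x^-1 = c n.+1 * - (- y)^-1 by rewrite invrN opprK /y invfM mulVKf.
by apply: intM => //; apply: intN.
Qed.

(** Dividing the minimal polynomial of x by its coefficient of least value gives a relation over A
    with a coefficient equal to 1, as [int_closure_val_rel] requires. *)
Lemma int_closure_valuation : is_valuation_ring B.
Proof.
split=> [|x y|x y|x x0]; [exact: int1 | exact: intB | exact: intM | ].
have /polyOver1P [q qE] := minPolyOver 1%AS x.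
have qm : q \is monic by rewrite -(map_monic (in_alg L)) -qE monic_minPoly.
have sq : size q = (size q).-1.+1 by rewrite prednK // size_poly_gt0 monic_neq0.
have [i0 min] := vle_argmin valA (fun i : 'I_(size q).-1.+1 => q`_i).
have q0 : q`_i0 != 0.
  have := min ord_max; rewrite /= -/(lead_coef q) (monicP qm) => -[b _ e].
  by apply: contra_eq_neq e => ->; rewrite mulr0 oner_eq0.
apply: (int_closure_val_rel (n := (size q).-1) (c := fun i => (q`_i / q`_i0)%:A)) => //.
- move=> i; apply: (int_alg L valA); have [lt|ge] := ltnP i (size q).-1.+1.
    exact: vle_div q0 (min (Ordinal lt)).
  by rewrite -sq in ge; rewrite nth_default // mul0r; apply: vring0 valA.
- have := root_minPoly 1%AS x; rewrite qE => /rootP.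
  rewrite (horner_coef_wide (n := (size q).-1.+1)) ?size_map_poly ?leqSpred // => e.
  rewrite (eq_bigr (fun i : 'I__ => (q`_i0)^-1%:A * ((map_poly (in_alg L) q)`_i * x ^+ i))).
    by rewrite -mulr_sumr e mulr0.
  by move=> i _; rewrite coef_map /= algLM mulrCA mulrA.
- exists i0; first by rewrite -ltnS.
  by rewrite divff // scale1r; split; rewrite ?oner_eq0 ?invr1 //; apply: int1.
Qed.
End IntegralClosureValuation.

(** * Residual independence of powers *)

Section ResidualIndependence.
Variables (K : fieldType) (A : K -> Prop).
Hypothesis valA : is_valuation_ring A.

Lemma vmax_mul_congr x y z t : A x -> A t -> vmax A (x - y) -> vmax A (z - t) ->
  vmax A (x * z - y * t).
Proof.
move=> Ax At mxy mzt; have -> : x * z - y * t = x * (z - t) + (x - y) * t by ring.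
by apply: (vmaxD valA); [apply: vmaxMl | apply: vmaxMr].
Qed.

Lemma vmax_exp_congr x y n : A x -> A y -> vmax A (x - y) -> vmax A (x ^+ n - y ^+ n).
Proof.
move=> Ax Ay mxy; elim: n => [|n IHn]; first by rewrite subrr; apply: vmax0.
by rewrite !exprS; apply: vmax_mul_congr => //; apply: vringX.
Qed.

Lemma vring_prod (I : Type) (r : seq I) (P : pred I) (E : I -> K) :
  (forall i, P i -> A (E i)) -> A (\prod_(i <- r | P i) E i).
Proof. by move=> AE; elim/big_ind: _ => //; [apply: vring1 | apply: vringM]. Qed.

Lemma det_congr n (M M' : 'M[K]_n) : (forall i j, A (M i j)) -> (forall i j, A (M' i j)) ->
  (forall i j, vmax A (M i j - M' i j)) -> A (\det M) /\ vmax A (\det M - \det M').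
Proof.
move=> AM AM' MM'.
have As (b : bool) : A ((-1) ^+ b) by apply: (vringX valA); apply: (vringN valA); exact: vring1.
split.
  by apply: vring_sum => // t _; apply: vringM => //; apply: vring_prod.
rewrite /determinant -sumrB; apply: vmax_sum => // t _; rewrite -mulrBr.
apply: vmaxMl => //; pose R (x y : K) := [/\ A x, A y & vmax A (x - y)].
suff: R (\prod_(i < n) M i (t i)) (\prod_(i < n) M' i (t i)) by case.
elim/big_ind2: _ => [|x y z w [Ax Ay mxy] [Az Aw mzw]|i _]; last by split.
  by split; [apply: vring1 | apply: vring1 | rewrite subrr; apply: vmax0].
by split; [apply: vringM | apply: vringM | apply: vmax_mul_congr].
Qed.

Variables (L : fieldExtType K) (B : L -> Prop) (p : nat).
Hypotheses (p_pr : prime p) (charK : p \in [pchar K]).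
Hypothesis valB : is_valuation_ring B.
Hypothesis BA : forall a, B a%:A <-> A a.

Lemma vmax_alg a : vmax B a%:A <-> vmax A a.
Proof.
rewrite /vmax -algLV !BA; split=> -[Aa [a0|?]]; split=> //; [left|by right|left|by right].
  by apply: (@algL_inj _ L); rewrite a0 scale0r.
by rewrite a0 scale0r.
Qed.

Variables (u : L) (phi : K).
Hypotheses (Bu : B u) (Aphi : A phi) (u_phi : vmax B (u ^+ p - phi%:A)).
Hypothesis u_res : forall c, A c -> ~ vmax B (u - c%:A).

(* The reduction of phi is not a p-th power, so x^p - phi stays irreducible over the
   residue field: if C represents multiplication by u on a residual relation of degree
   n < p, then det(C)^p = phi^n, and n is invertible mod p. *)
Lemma residual_free n (a : nat -> K) : (n <= p)%N -> (forall i, A (a i)) ->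
  vmax B (\sum_(i < n) (a i)%:A * u ^+ i) -> forall i, (i < n)%N -> vmax A (a i).
Proof.
elim: n a => // n IHn a np Aa msum.
have Bun k : B (u ^+ k) by apply: vringX.
have [man|nman] := EM (vmax A (a n)).
  move=> i; rewrite ltnS leq_eqVlt => /orP[/eqP-> //|]; apply: IHn; rewrite 1?ltnW //.
  move: msum; rewrite big_ord_recr /= => msum.
  rewrite -[X in vmax _ X](addrK ((a n)%:A * u ^+ n)); apply: vmaxBB => //.
  by apply: vmaxMr => //; apply/vmax_alg.
have [an0 Aan] := vmax_unit valA (Aa n) nman; exfalso.
pose r i := a i / a n; have Ar i : A (r i) by apply: vringM.
have mr : vmax B (\sum_(i < n) (r i)%:A * u ^+ i + u ^+ n).
  have := vmaxMl valB (proj2 (BA _) Aan) msum.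
  rewrite big_ord_recr /= mulrDr mulrA -algLM mulVf // scale1r mul1r mulr_sumr.
  by congr (vmax _ (_ + _)); apply: eq_bigr => j _; rewrite algLM mulrCA mulrA.
case: n => [|m] in IHn np a Aa msum nman an0 Aan r Ar mr *.
  by move: mr; rewrite big_ord0 add0r; apply: vmax1.
have Cn0 : coprime m.+1 p by rewrite coprime_sym prime_coprime // gtnNdvd.
(* Companion matrix of the residual relation: the last row rewrites u^(m+1), the other rows shift.
   [ev M i] evaluates row i of M on the powers of u. *)
pose C : 'M[K]_m.+1 := \matrix_(i, j) if i == m :> nat then - r j else (j == i.+1 :> nat)%:R.
pose ev (M : 'M[K]_m.+1) i : L := \sum_j (M i j)%:A * u ^+ j.
have AC i j : A (C i j).
  by rewrite mxE; case: ifP => _; [apply: vringN | apply: vring_nat].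
have evC i : vmax B (ev C i - u * u ^+ i).
  rewrite -exprS /ev; have [im|im] := eqVneq (i : nat) m.
    rewrite im (eq_bigr (fun j : 'I_m.+1 => - ((r j)%:A * u ^+ j))); last first.
      by move=> j _; rewrite mxE im eqxx scaleNr mulNr.
    by rewrite sumrN -opprD; apply: vmaxN.
  have im' : (i.+1 < m.+1)%N by rewrite ltnS ltn_neqAle im -ltnS ltn_ord.
  rewrite (bigD1 (Ordinal im')) //= mxE (negPf im) /= eqxx scale1r mul1r big1 ?addr0.
    by rewrite subrr; apply: vmax0.
  move=> j jn; rewrite mxE (negPf im); case: eqP => [e|_]; last by rewrite scale0r mul0r.
  by case/eqP: jn; apply: val_inj.
have evX k : (forall i j, A ((C ^+ k) i j)) /\ forall i, vmax B (ev (C ^+ k) i - u ^+ k * u ^+ i).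
  elim: k => [|k [AXk evXk]].
    split=> [i j|i]; first by rewrite expr0 mxE; apply: vring_nat.
    rewrite /ev expr0 (bigD1 i) //= mxE eqxx scale1r mul1r big1 ?addr0 ?subrr; first exact: vmax0.
    by move=> j ji; rewrite mxE eq_sym (negPf ji) scale0r mul0r.
  split=> [i j|i].
    by rewrite exprS mxE; apply: vring_sum => // l _; apply: vringM.
  have -> : ev (C ^+ k.+1) i - u ^+ k.+1 * u ^+ i =
     \sum_l (C i l)%:A * (ev (C ^+ k) l - u ^+ k * u ^+ l) + u ^+ k * (ev C i - u * u ^+ i).
    have -> : ev (C ^+ k.+1) i = \sum_l (C i l)%:A * ev (C ^+ k) l.
      under [RHS]eq_bigr do rewrite mulr_sumr.
      rewrite /ev exchange_big; apply: eq_bigr => j _ /=.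
      rewrite exprS mxE -[_%:A]/(in_alg L _) rmorph_sum mulr_suml; apply: eq_bigr => l _.
      by rewrite mulrA rmorphM.
    under [in RHS]eq_bigr do rewrite mulrBr.
    rewrite sumrB mulrBr [u ^+ k * ev C i]mulr_sumr exprSr.
    under [X in _ = _ - X + _]eq_bigr do rewrite mulrCA.
    by rewrite addrA subrK mulrA.
  apply: vmaxD => //; last exact: vmaxMl.
  by apply: vmax_sum => // l _; apply: vmaxMl => //; apply/BA.
(* C^p acts residually as u^p, that is as phi. Each row of C^p - phi is thus a shorter residual
   relation, whose coefficients vanish residually by induction; then take determinants. *)
have [Adet mdet] : A (\det C) /\ vmax A (\det C ^+ p - phi ^+ m.+1).
  have [ACp evCp] := evX p.
  have Aphi1 i j : A ((phi%:M : 'M_m.+1) i j) by rewrite mxE; apply: vringMn.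
  have mCp i j : vmax A ((C ^+ p) i j - (phi%:M : 'M_m.+1) i j).
    pose b k := (C ^+ p) i (inord k) - (phi%:M : 'M_m.+1) i (inord k).
    have -> : (C ^+ p) i j - (phi%:M : 'M_m.+1) i j = b j by rewrite /b inord_val.
    apply: IHn => //; [exact: ltnW | by move=> k; apply: vringB | ].
    have -> : \sum_(k < m.+1) (b k)%:A * u ^+ k =
       (ev (C ^+ p) i - u ^+ p * u ^+ i) + (u ^+ p - phi%:A) * u ^+ i.
      rewrite mulrBl addrA subrK.
      have -> : phi%:A * u ^+ i = \sum_(k < m.+1) ((phi%:M : 'M_m.+1) i k)%:A * u ^+ k.
        rewrite (bigD1 i) //= mxE eqxx mulr1n big1 ?addr0 // => k ki.
        by rewrite mxE eq_sym (negPf ki) mulr0n scale0r mul0r.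
      rewrite -sumrB; apply: eq_bigr => k _.
      by rewrite /b inord_val algLB mulrBl.
    by apply: vmaxD => //; apply: vmaxMr.
  have [_] := det_congr ACp Aphi1 mCp; rewrite det_scalar.
  have -> k : \det (C ^+ k) = \det C ^+ k.
    by elim: k => [|k IHk]; rewrite ?det1 // !exprS -IHk -det_mulmx.
  split=> //; have A0 i j : A ((0 : 'M[K]_m.+1) i j) by rewrite mxE; apply: vring0.
  rewrite /determinant; apply: vring_sum => // t _.
  by apply: vringM => //; [apply: (vringX valA); apply: (vringN valA); exact: vring1 | apply: vring_prod].
have nphi : ~ vmax A phi.
  move/vmax_alg => mphi; apply: (u_res (vring0 valA)); rewrite scale0r subr0.
  by apply: (vmax_expr valB (n := p)) => //; rewrite -[_ ^+ p](subrK phi%:A); apply: vmaxD.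
have [phi0 Aphi'] := vmax_unit valA Aphi nphi.
(* With (m + 1) x = y p + 1, the element c = det(C)^x / phi^y satisfies c^p = phi residually, so (u
   - c)^p is residually 0, against [u_res]. *)
have [x y xy _] := egcdnP p (ltn0Sn m).
rewrite (eqP Cn0) in xy.
pose c := \det C ^+ x / phi ^+ y.
have Ac : A c by apply: vringM => //; [apply: vringX | rewrite -exprVn; apply: vringX].
apply: (u_res Ac); apply: (vmax_expr valB (n := p)).
  by apply: vringB => //; apply/BA.
have -> : (u - c%:A) ^+ p = (u ^+ p - phi%:A) - (c ^+ p - phi)%:A.
  have cL : p \in [pchar L] := rmorph_pchar (in_alg L) charK.
  rewrite -(pFrobenius_autE cL) pFrobenius_autB_comm ?pFrobenius_autE; last exact: mulrC.
  by rewrite algLB algLX; ring.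
apply: vmaxBB => //; apply/vmax_alg.
have -> : c ^+ p - phi = ((\det C ^+ p) ^+ x - (phi ^+ m.+1) ^+ x) / phi ^+ (y * p).
  have py0 : phi ^+ y != 0 by rewrite expf_neq0.
  rewrite -!exprM [(m.+1 * x)%N]mulnC xy exprD expr1 [(p * x)%N]mulnC /c.
  rewrite expr_div_n -!exprM mulrBl mulrAC divff ?mul1r //.
  by rewrite expf_neq0.
apply: vmaxMr => //; last by rewrite -exprVn; apply: vringX.
by apply: vmax_exp_congr => //; apply: vringX.
Qed.
End ResidualIndependence.

(** * Expansions at a best approximation *)

Section BestApproximation.
Variables (K : fieldType) (L : fieldExtType K) (A : K -> Prop) (B : L -> Prop) (p : nat).
Hypotheses (valA : is_valuation_ring A) (valB : is_valuation_ring B).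
Hypothesis BA : forall a, B a%:A <-> A a.
Variables (f : {lrmorphism L -> L}) (alpha : L) (h : K).
Hypothesis asH : AS_aut p f alpha h.
Let p_pr := as_prime asH.
Let charK := as_pchar asH.
Hypothesis wild : forall c, ~ B (alpha - c%:A).

Local Notation le := (vle B).
Local Notation lt := (vlt B).

Variable c0 : K.
Hypothesis best : forall c, le (alpha - c%:A) (alpha - c0%:A).

Local Notation x := (alpha - c0%:A).

Let shift_eq : x ^+ p - x = (h - (c0 ^+ p - c0))%:A.
Proof. exact: as_eq (AS_aut_shift c0 asH). Qed.

Let x1 : lt x 1. Proof. by apply/vltx1/wild. Qed.
Let x0 : x != 0. Proof. exact: vlt_neq0 x1. Qed.

(** Put u = x / d. As x^p - x lies in K, u^p differs from an element phi of K by u d^(1-p), which is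
    small because v(d) = v(x) < 0. A residue c of u in K would make c0 + d c a better approximation
    than c0, so [residual_free] applies to u. *)
Lemma best_free_unramified d (a : nat -> K) (i0 : 'I_p) : d != 0 -> le d%:A x -> le x d%:A ->
  (forall j : 'I_p, le ((a i0)%:A * x ^+ i0) ((a j)%:A * x ^+ j)) ->
  ~ lt ((a i0)%:A * x ^+ i0) (\sum_(i < p) (a i)%:A * x ^+ i).
Proof.
move=> d0 dx xd min lty; set y := \sum_(i < p) _ in lty.
have := vlt_neq0 valB lty; set E := (a i0)%:A * _ => E0.
have ai0 : a i0 != 0 by apply: contraNneq E0 => e; rewrite /E e scale0r mul0r.
have d0L : d%:A != 0 :> L by rewrite algL_eq0.
pose u := x / d%:A; have u0 : u != 0 by rewrite mulf_neq0 ?invr_eq0.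
have Bu : B u by apply: vle_div.
have Bu' : B u^-1 by rewrite invf_div; apply: vle_div.
pose phi := (h - (c0 ^+ p - c0)) / d ^+ p.
have u_phi : vmax B (u ^+ p - phi%:A).
  have -> : u ^+ p - phi%:A = u * (d^-1)%:A ^+ p.-1.
    rewrite /phi algLM [(d ^- p)%:A]algLV algLX -shift_eq /u expr_div_n -mulrBl opprB addrC subrK.
    by rewrite -mulrA algLV exprVn; congr (_ * _); rewrite -invfM -exprS prednK ?prime_gt0.
  apply: (vmaxMl valB Bu); have p1 : (0 < p.-1)%N by rewrite -ltnS prednK ?prime_gt1 ?prime_gt0.
  have md : vmax B (d^-1)%:A.
    rewrite algLV -[_^-1]mul1r; apply: vlt_div => //.
    exact: vle_lt_trans x1.
  rewrite -(prednK p1) exprS; apply: vmaxMr => //.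
  by apply: vringX => //; apply: vmaxB md.
have Aphi : A phi.
  by apply/BA; rewrite -(subKr (u ^+ p) phi%:A); apply: vringB => //; [apply: vringX | apply: vmaxB].
have u_res c : A c -> ~ vmax B (u - c%:A).
  move=> Ac /(vlt1 valB) /(vltM2l d0L); rewrite mulr1.
  have -> : d%:A * (u - c%:A) = alpha - (c0 + d * c)%:A.
    by rewrite mulrBr mulrC divfK // scalerDl algLM opprD addrA.
  by move=> lt1; apply: (vle_lt_trans valB xd lt1); exact: best.
(* Dividing by the term of least value puts all coefficients in A and makes the one at i0 equal to
   1; the value 0 beyond p only makes b total. *)
pose b i := if (i < p)%N then a i * d ^+ i / (a i0 * d ^+ i0) else 0.
have bE i : (i < p)%N -> (b i)%:A * u ^+ i = (a i)%:A * x ^+ i / E * u ^+ i0.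
  move=> ip; rewrite /b ip !algLM algLV algLM !algLX /u /E !expr_div_n; field.
  by rewrite !expf_neq0 ?algL_eq0 ?ai0 ?d0.
have Ab i : A (b i).
  have [ip|pi] := ltnP i p; last by rewrite /b ltnNge pi; apply: vring0.
  apply/BA; have -> : (b i)%:A = (a i)%:A * x ^+ i / E * u ^+ i0 * u^-1 ^+ i.
    by rewrite -bE // -mulrA -exprMn mulfV // expr1n mulr1.
  apply: vringM => //; last exact: vringX.
  apply: vringM => //; last exact: vringX.
  exact: vle_div (min (Ordinal ip)).
have mb : vmax B (\sum_(i < p) (b i)%:A * u ^+ i).
  rewrite (eq_bigr (fun i : 'I_p => ((a i)%:A * x ^+ i) * (E^-1 * u ^+ i0))).
    rewrite -mulr_suml mulrA; apply: vmaxMr => //; last exact: vringX.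
    exact: vlt_div.
  by move=> i _; rewrite bE // mulrA.
have := residual_free valA p_pr charK valB BA Bu Aphi u_phi u_res (leqnn p) Ab mb (ltn_ord i0).
rewrite /b ltn_ord divff; first exact: vmax1.
by rewrite mulf_neq0 ?expf_neq0.
Qed.

(** Since v(x) < 0, x^p has the value of g = x^p - x, an element of K. If x^n also has a value from
    K with 0 < n < p, a Bezout relation r n = s p + 1 gives x the value of e^r / g^s. *)
Lemma best_ramified n e : (0 < n < p)%N -> le (x ^+ n) e%:A -> le e%:A (x ^+ n) ->
  exists d, [/\ d != 0, le d%:A x & le x d%:A].
Proof.
case/andP=> n0 np ne en; set g := h - (c0 ^+ p - c0).
have gE : g%:A = x ^+ p - x by rewrite shift_eq.
have ltx : lt (x ^+ p) (- x).
  by apply: vltN => //; rewrite -[X in vlt _ _ X]expr1; apply: vlt_exp2l => //; apply: prime_gt1.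
have gx : le g%:A (x ^+ p) by rewrite gE; apply: vlt_addr.
have xg : le (x ^+ p) g%:A by rewrite gE; apply: vle_addr.
have g0 : g%:A != 0 :> L.
  apply/eqP => g0; move: gx; rewrite g0 => /vle0l /eqP.
  by apply/negP; rewrite expf_neq0.
have [r s rs _] := egcdnP p n0.
have cop : coprime n p by rewrite coprime_sym prime_coprime // gtnNdvd.
rewrite (eqP cop) in rs.
have e0 : e%:A != 0 :> L.
  apply/eqP => e0; move: en; rewrite e0 => /vle0l /eqP.
  by apply/negP; rewrite expf_neq0.
have gs0 : g%:A ^+ s != 0 :> L by rewrite expf_neq0.
exists (e ^+ r / g ^+ s); have dE : (e ^+ r / g ^+ s)%:A * g%:A ^+ s = e%:A ^+ r :> L.
  by rewrite algLM algLV !algLX divfK.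
have xE : (x ^+ n) ^+ r = x * (x ^+ p) ^+ s.
  by rewrite -!exprM mulnC rs exprD expr1 mulrC mulnC.
split.
- by rewrite -(algL_eq0 L) algLM algLV !algLX mulf_neq0 ?invr_eq0 ?expf_neq0.
- apply: (vle_pM2l (z := g%:A ^+ s)) => //; rewrite ![g%:A ^+ s * _]mulrC dE.
  apply: (vle_trans valB (vleX valB r en)); rewrite xE.
  by apply: vleM2l; apply: vleX.
- apply: (vle_pM2l (z := g%:A ^+ s)) => //; rewrite ![g%:A ^+ s * _]mulrC dE.
  apply: (vle_trans valB _ (vleX valB r ne)); rewrite xE.
  by apply: vleM2l; apply: vleX.
Qed.

(** If v(x) is not a value from K, two nonzero terms of equal value would contradict
    [best_ramified]; the least term is then strictly least and cannot cancel. *)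
Lemma best_free (a : nat -> K) i : (i < p)%N ->
  le (\sum_(j < p) (a j)%:A * x ^+ j) ((a i)%:A * x ^+ i).
Proof.
set y := \sum_(j < p) _ => ip.
have [i0 min] : exists i0 : 'I_p, forall j : 'I_p, le ((a i0)%:A * x ^+ i0) ((a j)%:A * x ^+ j).
  rewrite -(prednK (prime_gt0 p_pr)).
  exact: (vle_argmin valB (fun j : 'I_p.-1.+1 => (a j)%:A * x ^+ j)).
apply: (vle_trans valB _ (min (Ordinal ip))); apply: contrapT => lty.
have [[d [d0 dx xd]]|nd] := EM (exists d, [/\ d != 0, le d%:A x & le x d%:A]).
  exact: best_free_unramified d0 dx xd min lty.
set E := (a i0)%:A * _ in lty min.
have E0 : E != 0 := vlt_neq0 valB lty.
have distinct (k j : nat) : (k < j < p)%N -> (a j)%:A * x ^+ j != 0 ->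
    le ((a k)%:A * x ^+ k) ((a j)%:A * x ^+ j) -> ~ le ((a j)%:A * x ^+ j) ((a k)%:A * x ^+ k).
  move=> /andP[kj jp] Ej0 lekj lejk; apply: nd.
  have aj0 : (a j)%:A != 0 :> L by apply: contraNneq Ej0 => ->; rewrite mul0r.
  have xk0 : x ^+ k != 0 by rewrite expf_neq0.
  apply: (@best_ramified (j - k) (a k / a j)).
  - by rewrite subn_gt0 kj (leq_ltn_trans (leq_subr _ _)).
  - apply: (vle_pM2l (z := (a j)%:A * x ^+ k)); first by rewrite mulf_neq0.
    rewrite -[_ * x ^+ k * x ^+ (j - k)]mulrA -exprD subnKC ?(ltnW kj) //.
    by rewrite mulrAC [(_ / _)%:A]algLM algLV (mulrC (a k)%:A) mulVKf.
  - apply: (vle_pM2l (z := (a j)%:A * x ^+ k)); first by rewrite mulf_neq0.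
    rewrite -[_ * x ^+ k * x ^+ (j - k)]mulrA -exprD subnKC ?(ltnW kj) //.
    by rewrite mulrAC [(_ / _)%:A]algLM algLV (mulrC (a k)%:A) mulVKf.
apply: lty; rewrite /y (bigD1 i0) //=; apply: vlt_addr => //.
apply: vlt_sum => // j ji0 leji.
have Ej0 : (a j)%:A * x ^+ j != 0.
  by apply/eqP => e; move: leji; rewrite e => /vle0l/eqP; apply/negP.
have [lt_ji|lt_ij|e] := ltngtP j i0; last by case/eqP: ji0; apply: val_inj.
  by apply: (@distinct j i0); rewrite ?lt_ji ?ltn_ord.
by apply: (@distinct i0 j); rewrite ?lt_ij ?ltn_ord.
Qed.
End BestApproximation.

(** * Expansions without a best approximation *)

Lemma size_deriv_pred (R : nzRingType) (q : {poly R}) : (size q^`() <= (size q).-1)%N.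
Proof.
have [->|q0] := eqVneq q 0; first by rewrite derivC size_poly0.
by rewrite -ltnS prednK ?size_poly_gt0 // lt_size_deriv.
Qed.

(** One factor y is kept next to t z^(k+1) to match a linear bound; only y^k is then absorbed. *)
Lemma mul_exprMSn (R : comNzRingType) (t y z : R) k :
  t * (y * z) ^+ k.+1 = y ^+ k * (y * (t * z ^+ k.+1)).
Proof. by rewrite exprMn mulrCA [y ^+ k.+1]exprSr -!mulrA. Qed.

Lemma vring_natV (K : fieldType) (A : K -> Prop) p n : is_valuation_ring A ->
  p \in [pchar K] -> ~~ (p %| n)%N -> A (n%:R^-1).
Proof.
move=> valA charK pn; have n0 : n%:R != 0 :> K by rewrite -(dvdn_pcharf charK).
have p1 : (1 < p)%N by apply/prime_gt1/(pcharf_prime charK).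
(* Fermat: n^p = n in characteristic p. *)
have -> : n%:R^-1 = n%:R ^+ p.-2 :> K.
  apply: (mulfI n0); apply: (mulfI n0); rewrite divff // mulr1 -!exprS.
  have -> : p.-2.+2 = p by case: (p) p1 => [|[]].
  by rewrite natL_exp.
by apply: (vringX valA); apply: (vring_nat valA).
Qed.

Lemma vmax_horner (K : fieldType) (A : K -> Prop) (q : {poly K}) z :
  is_valuation_ring A -> (forall i, vmax A q`_i) -> A z -> vmax A q.[z].
Proof.
move=> valA mq Az; rewrite horner_coef; apply: (vmax_sum valA) => i _.
by apply: (vmaxMr valA) => //; apply: (vringX valA).
Qed.

Section Taylor.
Variables (K : fieldType) (g : {poly K}) (c : K).

(** Reading the coefficient off g(X + c) avoids dividing iterated derivatives by factorials in
    characteristic p. *)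
Definition taylor i := (g \Po ('X + c%:P))`_i.

Lemma taylor_horner n z : (size g <= n)%N ->
  g.[c + z] = \sum_(i < n) taylor i * z ^+ i.
Proof.
move=> sg; have -> : g.[c + z] = (g \Po ('X + c%:P)).[z].
  by rewrite horner_comp hornerD hornerX hornerC addrC.
by apply: horner_coef_wide; rewrite size_comp_poly2 // size_XaddC.
Qed.

Lemma taylor_large n i : (size g <= n)%N -> (n <= i)%N -> taylor i = 0.
Proof.
move=> sg ni; rewrite /taylor nth_default // size_comp_poly2 ?size_XaddC //.
exact: leq_trans ni.
Qed.

Lemma taylor0 : taylor 0 = g.[c].
Proof.
rewrite -[c in RHS]addr0 (taylor_horner (n := (size g).+1)) // big_ord_recl expr0 mulr1.
by rewrite big1 ?addr0 // => i _; rewrite expr0n mulr0.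
Qed.
End Taylor.

Lemma taylor_deriv (K : fieldType) (g : {poly K}) c i :
  taylor g^`() c i = taylor g c i.+1 *+ i.+1.
Proof.
by rewrite /taylor -coef_deriv deriv_comp derivD derivX derivC addr0 mulr1.
Qed.

Lemma taylor_alg (K : fieldType) (L : fieldExtType K) (g : {poly K}) (c : K) n (y : L) :
  (size g <= n)%N ->
  (map_poly (in_alg L) g).[y] = \sum_(i < n) (taylor g c i)%:A * (y - c%:A) ^+ i.
Proof.
move=> sg; have := @taylor_horner L (map_poly (in_alg L) g) c%:A n (y - c%:A).
rewrite size_map_poly addrC subrK => ->//; apply: eq_bigr => i _; congr (_ * _).
rewrite /taylor; have -> : 'X + (c%:A)%:P = map_poly (in_alg L) ('X + c%:P).
  by rewrite rmorphD /= map_polyX map_polyC.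
by rewrite -map_comp_poly coef_map.
Qed.

Section NoBestApproximation.
Variables (K : fieldType) (L : fieldExtType K) (A : K -> Prop) (B : L -> Prop) (p : nat).
Hypotheses (p_pr : prime p) (charK : p \in [pchar K]).
Hypotheses (valA : is_valuation_ring A) (valB : is_valuation_ring B) (henA : henselian A).
Hypothesis BA : forall a, B a%:A <-> A a.
Variable alpha : L.
Hypothesis wild : forall c, ~ B (alpha - c%:A).
Hypothesis nobest : forall c, exists c', vlt B (alpha - c%:A) (alpha - c'%:A).

Local Notation le := (vle B).
Local Notation lt := (vlt B).
Local Notation mapL := (map_poly (in_alg L)).

Let shift_neq0 c : alpha - c%:A != 0.
Proof. by apply/eqP => e; apply: (wild (c := c)); rewrite e; apply: vring0. Qed.

Section Newton.
Variables (g : {poly K}) (c0 : K).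
Hypothesis sg : (size g <= p)%N.
Local Notation x0 := (alpha - c0%:A).
Local Notation D := (mapL g^`()).[alpha].
(** [stable] is what the induction hypothesis for g' says about g, and [small] is the obstruction to
    be refuted. *)
Hypothesis stable : forall c i, le x0 (alpha - c%:A) -> (0 < i)%N ->
  le (D * x0) ((taylor g c i)%:A * x0 ^+ i).
Hypothesis small : forall c, lt (D * (alpha - c%:A)) (mapL g).[alpha].

Let D0 : D != 0.
Proof. by have := vlt_neq0 valB (@small 0); rewrite mulf_eq0 negb_or => /andP[]. Qed.

Let Dx0 c : D * (alpha - c%:A) != 0. Proof. by rewrite mulf_neq0. Qed.

(** Passing from x0 to x = b x0 with v(b) > 0 multiplies the i-th term by b^i but the linear bound D
    x0 only by b, so for i >= 2 the inequality becomes strict. *)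
Lemma newton_higher c i : lt x0 (alpha - c%:A) -> (1 < i)%N ->
  lt (D * (alpha - c%:A)) ((taylor g c i)%:A * (alpha - c%:A) ^+ i).
Proof.
set x := alpha - c%:A => x0x; case: i => // [[|i]] // _.
have Dx : D * x != 0 by apply: Dx0.
have xE : x = x / x0 * x0 by rewrite divfK.
have mb : vmax B (x / x0) by apply: vlt_div.
set b := x / x0 in xE mb; have Bb := vmaxB mb.
pose z := b * ((taylor g c i.+2)%:A * x0 ^+ i.+2).
have -> : (taylor g c i.+2)%:A * x ^+ i.+2 = b ^+ i.+1 * z by rewrite xE mul_exprMSn.
have Dz : le (D * x) z.
  by rewrite [in D * x]xE mulrCA; apply/vleM2l/stable => //; apply: vltW.
apply: (vlt_le_trans valB) (vleM2l _ Dz); rewrite -[X in vlt _ X _]mul1r.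
apply: vltM2r => //; apply/(vlt1 valB); rewrite exprS.
by apply: vmaxMr => //; apply: vringX.
Qed.

(** In the expansion of g'(alpha) at c the constant term is g'(c), and [newton_higher] divided by x
    makes all other terms strictly larger in value. *)
Lemma newton_linear c : lt x0 (alpha - c%:A) ->
  le D (taylor g c 1)%:A /\ le (taylor g c 1)%:A D.
Proof.
move=> x0x; set x := alpha - c%:A in x0x *.
have sg' : (size g^`() <= p)%N.
  by apply: leq_trans sg; rewrite (leq_trans (size_deriv_pred _)) // leq_pred.
have := taylor_alg c alpha sg'; rewrite -/x -(prednK (prime_gt0 p_pr)) big_ord_recl expr0 mulr1.
set R := \sum_(i < _) _ => DE; rewrite taylor_deriv mulr1n in DE.
have DR : lt D R.
  apply: vlt_sum => // i _; rewrite taylor_deriv lift0.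
  have x0' : x != 0 by apply: shift_neq0.
  have nle := newton_higher x0x (isT : 1 < i.+2)%N.
  have := vltM2r (_ : x^-1 != 0) nle; rewrite invr_eq0 => /(_ x0').
  rewrite mulfK // -mulrA exprSr mulfK // => lt1.
  apply: (vlt_le_trans valB lt1); exists (i.+2)%:R; first exact: vring_nat.
  by rewrite algLMn !mulrnAl mul1r.
have -> : (taylor g c 1)%:A = D - R by rewrite DE addrK.
by split; [apply: vle_addr | apply: vlt_addr] => //; apply: vltN.
Qed.

Lemma newton_expand c : exists2 R, lt x0 (alpha - c%:A) -> lt (D * (alpha - c%:A)) R &
  (mapL g).[alpha] = (taylor g c 0)%:A + (taylor g c 1)%:A * (alpha - c%:A) + R.
Proof.
have p2 : p = p.-2.+2 by case: (p) (prime_gt1 p_pr) => [|[]].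
have := taylor_alg c alpha sg; rewrite p2 2!big_ord_recl expr0 expr1 mulr1 addrA.
set R := \sum_(i < _) _ => e; exists R => // x0x; apply: vlt_sum => // i _.
exact: (newton_higher x0x).
Qed.

(* P is the reciprocal polynomial, up to sign, of the expansion of g at c rescaled by the
   Newton step d: reversing it makes it monic, and its simple residual root is 1. *)
Lemma newton_contra : False.
Proof.
have [c x0x] := nobest c0; set x := alpha - c%:A in x0x.
have [R /(_ x0x) ltR gE] := newton_expand c; rewrite -/x in ltR gE.
have [Dt1 t1D] := newton_linear x0x.
set t := taylor g c in gE Dt1 t1D.
have x_neq0 : x != 0 := shift_neq0 c.
have t1L : (t 1%N)%:A != 0 :> L.
  by apply/eqP => e; move: t1D; rewrite e => /vle0l/eqP; apply/negP.
have t1_neq0 : t 1%N != 0 by rewrite algL_eq0 in t1L.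
(* The Newton step -g(c) / g'(c). By [small], g(c) + g'(c) x = g'(c) (x - d) has value above v(D x),
   so v(x - d) > v(x) and v(d) = v(x). *)
pose d := - t 0%N / t 1%N.
have t1d : t 1%N * d = - t 0%N by rewrite mulrC divfK.
clearbody d.
have lt_xd : lt x (x - d%:A).
  move=> /(vleM2l (t 1%N)%:A); rewrite mulrBr -algLM t1d scaleNr opprK addrC.
  move=> le1; apply: (_ : lt (D * x) ((t 0%N)%:A + (t 1%N)%:A * x)).
    rewrite -(addrK R (_ + _)) -gE; apply: vltB => //; exact: small.
  by apply: (vle_trans valB le1); apply: vleM2r.
have dE : d%:A = x - (x - d%:A) by rewrite subKr.
have le_xd : le x d%:A by rewrite dE; apply: vle_addr => //; apply: vltN.
have le_dx : le d%:A x by rewrite dE; apply: vlt_addr => //; apply: vltN.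
have dL : d%:A != 0 :> L.
  by apply/eqP => e; move: le_dx; rewrite e => /vle0l/eqP; apply/negP.
have d_neq0 : d != 0 by rewrite algL_eq0 in dL.
pose m i := t i * d ^+ i / (t 1%N * d).
have mm i : (1 < i)%N -> vmax A (m i).
  move=> i1; apply/(vmax_alg BA); rewrite /m algLM algLV; apply: vlt_div => //.
    by rewrite algL_eq0 mulf_neq0.
  rewrite [(_ * d)%:A]algLM [(t i * _)%:A]algLM algLX; apply: (vle_lt_trans valB (vleM valB t1D le_dx)) => //.
  apply: (vlt_le_trans valB (newton_higher x0x i1)).
  by apply/vleM2l/vleX.
have [q pE] : exists q, p = q.+2 by exists p.-2; case: (p) (prime_gt1 p_pr) => [|[]].
(* As i runs from 0 to p - 2, p - i covers the terms of index at least 2, and for nonzero b one gets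
   b^p g(c + d/b) = - g'(c) d P(b). *)
pose Q := \poly_(i < q.+1) m (p - i)%N.
have mQ i : vmax A Q`_i.
  rewrite coef_poly; case: ltnP => iq; last exact: vmax0.
  by apply: mm; rewrite pE ltn_subRL addn1 -[(i.+1 < _)%N]ltnS.
pose P := 'X^p - 'X^(q.+1) - Q.
have P1 : P.[1] = - Q.[1].
  by rewrite /P !hornerD !hornerN !hornerXn !expr1n subrr add0r.
have Pm : P \is monic.
  have sz : (size (- 'X^(q.+1) - Q)%R < size ('X^p : {poly K}))%N.
    rewrite size_polyXn ltnS -opprD size_polyN (leq_trans (size_polyD _ _)) // geq_max.
    by rewrite size_polyXn pE leqnn (leq_trans (size_poly _ _)).
  by rewrite monicE /P -addrA lead_coefDl // lead_coefXn.
have AP i : A P`_i.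
  rewrite !coefB !coefXn; apply: vringB => //; last exact: (vmaxB (mQ i)).
  by apply: vringB => //; apply: vring_nat.
have mP1 : vmax A P.[1].
  by rewrite P1; apply: vmaxN => //; apply: vmax_horner => //; apply: vring1.
have mP'1 : ~ vmax A P^`().[1].
  have -> : P^`().[1] = 1 - Q^`().[1].
    rewrite /P !derivB !derivXn !hornerD !hornerN !hornerMn !hornerXn !expr1n.
    by rewrite -[1 *+ q.+1](addrK 1) natr1 -pE opprB addrCA subrr addr0.
  have mQ' : vmax A Q^`().[1].
    apply: vmax_horner => // [i|]; last exact: vring1.
    by rewrite coef_deriv -mulr_natr; apply: vmaxMr => //; apply: vring_nat.
  by move=> m1; have := vmaxD valA m1 mQ'; rewrite subrK; apply: vmax1.
have [b [Ab rb mb]] := henA Pm AP (vring1 valA) mP1 mP'1.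
have b1 : ~ vmax A b.
  by move=> mb'; have := vmaxBB valA mb' mb; rewrite subKr; apply: vmax1.
have [b0 Ab'] := vmax_unit valA Ab b1.
have bL : b%:A != 0 :> L by rewrite algL_eq0.
have gc : g.[c + d / b] = 0.
  have b_neq : b ^+ p != 0 by rewrite expf_neq0.
  apply: (mulfI b_neq); rewrite mulr0.
  rewrite (@taylor_horner _ g c q.+3) -/t; last by rewrite -pE (leq_trans sg).
  have QE : Q.[b] = \sum_(i < q.+1) m i.+2 * b ^+ (q - i).
    rewrite horner_poly (reindex_inj rev_ord_inj) /=; apply: eq_bigr => i _.
    by rewrite pE subSS -addn2 -addnBAC ?leq_subr // subKn ?addn2 // -ltnS.
  rewrite 2!big_ord_recl expr0 mulr1 expr1 addrA mulrDr.
  have -> : b ^+ p * (\sum_(i < q.+1) t (lift ord0 (lift ord0 i)) * (d / b) ^+ lift ord0 (lift ord0 i))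
     = t 1%N * d * Q.[b].
    rewrite QE !mulr_sumr; apply: eq_bigr => i _; rewrite !lift0 /m.
    have -> : b ^+ p = b ^+ i.+2 * b ^+ (q - i) by rewrite -exprD pE addSn addSn subnKC // -ltnS.
    rewrite expr_div_n; field.
    by rewrite t1_neq0 d_neq0 expf_neq0.
  have -> : t 0%N = - (t 1%N * d) by rewrite t1d opprK.
  move: rb => /rootP; rewrite /P !hornerD !hornerN !hornerXn => rb.
  have -> : Q.[b] = b ^+ p - b ^+ q.+1.
    by apply/eqP; rewrite eq_sym -subr_eq0 rb.
  rewrite lift0 pE exprS; field.
  by [].
have lt_x : lt x (alpha - (c + d / b)%:A).
  have -> : alpha - (c + d / b)%:A = (x - d%:A) + ((b - 1) / b)%:A * d%:A.
    by rewrite /x scalerDl opprD addrA !algLM algLB scale1r algLV; field.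
  apply: vltD => //; apply: (vlt_le_trans valB) (vleM2l _ le_xd).
  rewrite -[X in vlt _ X _]mul1r; apply: vltM2r => //; apply/(vlt1 valB)/(vmax_alg BA).
  exact: vmaxMr.
have x0x' : lt x0 (alpha - (c + d / b)%:A).
  exact: (vlt_le_trans valB x0x (vltW valB lt_x)).
(* At the exact root c' = c + d/b the constant term vanishes, so g'(c') (alpha - c') would have
   value above v(D (alpha - c')), although v(g'(c')) <= v(D). *)
have [R' /(_ x0x') ltR' gE'] := newton_expand (c + d / b).
have [_ t1D'] := newton_linear x0x'.
have := vltB valB (@small (c + d / b)) ltR'.
by rewrite gE' addrK taylor0 gc scale0r add0r; apply; apply: vleM2r.
Qed.
End Newton.

(** The coefficients are taken at every later centre c while the powers stay at c0: in this form the
    bound for g' can still be used after c0 is improved. It controls the indices i >= 1 because i is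
    invertible in A for 0 < i < p; the constant term is g(alpha) minus the others. *)
Lemma stable_expansion n (g : {poly K}) : (n <= p)%N -> (size g <= n)%N ->
  exists c0, forall c, le (alpha - c0%:A) (alpha - c%:A) -> forall i,
    le (mapL g).[alpha] ((taylor g c i)%:A * (alpha - c0%:A) ^+ i).
Proof.
elim: n g => [|n IHn] g np sg.
  exists 0 => c _ i; rewrite (@taylor_large _ _ _ 0) // scale0r mul0r.
  exact: vle0.
have sg' : (size g^`() <= n)%N.
  by apply: leq_trans (size_deriv_pred g) _; case: (size g) sg.
have [c0 IH] := IHn _ (ltnW np) sg'; set D := (mapL g^`()).[alpha] in IH.
have stable c i : le (alpha - c0%:A) (alpha - c%:A) -> (0 < i)%N ->
    le (D * (alpha - c0%:A)) ((taylor g c i)%:A * (alpha - c0%:A) ^+ i).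
  case: i => // i c0c _; have [lt_ip|le_pi] := ltnP i.+1 p; last first.
    rewrite (@taylor_large _ _ _ p) ?(leq_trans sg) // scale0r mul0r; exact: vle0.
  have := vleM2r (alpha - c0%:A) (IH c c0c i); rewrite taylor_deriv => /(vle_trans valB).
  apply; exists ((i.+1)%:R^-1)%:A.
    by apply/BA/(vring_natV valA charK); rewrite gtnNdvd.
  have i0 : (i.+1)%:R != 0 :> K by rewrite -(dvdn_pcharf charK) gtnNdvd.
  rewrite -[taylor g c _ *+ _]mulr_natl algLM exprSr !mulrA.
  by rewrite -[X in _ = X * _ * _ * _]algLM mulVf // scale1r mul1r.
have [[c1 le1]|nle] := EM (exists c1, le (mapL g).[alpha] (D * (alpha - c1%:A))); last first.
  exfalso; apply: (@newton_contra g c0) => // [|c]; first exact: leq_trans np.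
  by move=> le1; apply: nle; exists c.
have [c2 [le02 le12]] : exists c2, le (alpha - c0%:A) (alpha - c2%:A) /\ le (alpha - c1%:A) (alpha - c2%:A).
  case: (vle_total valB (alpha - c0%:A) (alpha - c1%:A)) => ?; last first.
    by exists c0; split=> //; apply: vle_refl.
  by exists c1; split=> //; apply: vle_refl.
exists c2 => c le2.
have pos i : (0 < i)%N -> le (mapL g).[alpha] ((taylor g c i)%:A * (alpha - c2%:A) ^+ i).
  case: i => // i _; apply: (vle_trans valB le1).
  apply: (vle_trans valB (vleM2l D le12)).
  case: (le02) => b Bb ->.
  have -> : (taylor g c i.+1)%:A * (b * (alpha - c0%:A)) ^+ i.+1 =
    b ^+ i * (b * ((taylor g c i.+1)%:A * (alpha - c0%:A) ^+ i.+1)) by rewrite mul_exprMSn.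
  rewrite mulrCA; apply: (vle_trans valB (vleM2l b (stable c i.+1 (vle_trans valB le02 le2) isT))).
  by exists (b ^+ i) => //; apply: vringX.
case=> [|i]; last exact: pos.
have := taylor_alg c alpha sg; rewrite big_ord_recl !expr0 !mulr1.
set S := \sum_(i < n) _ => e; have -> : (taylor g c 0)%:A = (mapL g).[alpha] - S by rewrite e addrK.
apply: vleB; [by [] | exact: vle_refl | apply: vle_sum => // i _].
apply: (vle_trans valB (pos i.+1 isT)); rewrite lift0.
by apply/vleM2l/vleX.
Qed.
End NoBestApproximation.

(** * Norms of conjugate ratios *)

Section NormOfConjugateRatio.
Variables (p : nat) (K : fieldType) (L : fieldExtType K) (A : K -> Prop).
Hypotheses (valA : is_valuation_ring A) (henA : henselian A).
Variables (f : {lrmorphism L -> L}) (alpha : L) (h : K).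
Hypothesis asH : AS_aut p f alpha h.
Local Notation B := (@int_closure K L A).
Local Notation N := (@normLK K L).
Local Notation mapL := (map_poly (in_alg L)).

Let p_pr := as_prime asH.
Let charK := as_pchar asH.
Let valB : is_valuation_ring B := int_closure_valuation valA henA asH.

Let BA a : B a%:A <-> A a.
Proof. by split; [apply: int_algP | apply: int_alg]. Qed.

(** The ratio or its inverse is integral, and an integral element of norm 1 is a unit. *)
Lemma int_closure_ratio b : b != 0 -> B (f b / b).
Proof.
move=> b0; apply: contrapT => nB; have BV := vring_inv valB nB.
have fb0 : f b != 0 by rewrite fmorph_eq0.
have N1 : N (f b / b)^-1 = 1.
  rewrite (normLKV asH) (normLKM asH) (normLKV asH) (normLK_lriter asH 1 b : N (f b) = _).
  by rewrite divff ?invr1 // (normLK_eq0 asH).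
have [|_] := normLK_unit valA asH BV; first by rewrite N1; apply: vmax1.
by rewrite invrK.
Qed.

(** The difference is a sum of products of k factors x or x + 1, and v(x + 1) >= v(x) because v(x)
    <= 0. *)
Lemma conj_difference_pow x k : vle B x 1 -> vle B (x ^+ k) ((x + 1) ^+ k.+1 - x ^+ k.+1).
Proof.
move=> x1; have xx1 : vle B x (x + 1) by apply: vleD => //; apply: vle_refl.
elim: k => [|k IHk]; first by rewrite !expr1 addrC addKr expr0; apply: vle_refl.
have -> : (x + 1) ^+ k.+2 - x ^+ k.+2 =
  (x + 1) * ((x + 1) ^+ k.+1 - x ^+ k.+1) + x ^+ k.+1.
  by rewrite [(x + 1) ^+ k.+2]exprS [x ^+ k.+2]exprS; ring.
by apply: vleD => //; [rewrite [X in vle _ X _]exprS; apply: vleM | apply: vle_refl].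
Qed.

Lemma good_expansion (g : {poly K}) : (size g <= p)%N -> (forall c, ~ B (alpha - c%:A)) ->
  exists c, forall i, vle B (mapL g).[alpha] ((taylor g c i)%:A * (alpha - c%:A) ^+ i).
Proof.
move=> sg wild.
have [[c0 best]|nb] := EM (exists c0, forall c, vle B (alpha - c%:A) (alpha - c0%:A)).
  exists c0 => i; have [ip|pi] := ltnP i p; last first.
    by rewrite (@taylor_large _ _ _ p) // scale0r mul0r; apply: vle0.
  rewrite (taylor_alg c0 alpha sg).
  exact: (best_free valA valB BA asH wild best).
have nobest c : exists c', vlt B (alpha - c%:A) (alpha - c'%:A).
  apply: contrapT => nex; apply: nb; exists c => c'; apply: contrapT => nle.
  by apply: nex; exists c'.
have [c0 st] := stable_expansion p_pr charK valA valB henA BA wild nobest (leqnn p) sg.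
by exists c0 => i; apply: st; apply: vle_refl.
Qed.

Lemma conj_ratio_bound b : b != 0 -> exists c, B ((alpha - c%:A) * (f b / b - 1)).
Proof.
move=> b0.
(* If some alpha - c is integral, that c works at once; otherwise every alpha - c has negative
   value. *)
have [[c Bc]|wild] := EM (exists c, B (alpha - c%:A)).
  exists c; apply: intM => //; apply: intB => //; last exact: int1.
  exact: int_closure_ratio.
have {}wild c : ~ B (alpha - c%:A) by move=> Bc; apply: wild; exists c.
have [g sg bE] := alpha_repr asH b.
have [c good] := good_expansion sg wild; rewrite -bE in good.
exists c; set x := alpha - c%:A in good *.
have -> : x * (f b / b - 1) = x * (f b - b) / b.
  by field.
apply: vle_div => //; have ltx1 : vlt B x 1 by apply/vltx1/wild.
have x1 := vltW valB ltx1.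
have fbE : f b - b = \sum_(i < p) (taylor g c i)%:A * ((x + 1) ^+ i - x ^+ i).
  have e := taylor_alg c alpha sg; rewrite -bE -/x in e.
  rewrite {1}e rmorph_sum {1}e -sumrB; apply: eq_bigr => i _.
  rewrite rmorphM rmorphXn /= [f _%:A](s_alg f 1) mulrBr.
  by rewrite (as_conj (AS_aut_shift c asH)).
rewrite fbE mulr_sumr; apply: vle_sum => // i _; rewrite mulrCA.
case: (nat_of_ord i) => [|k]; first by rewrite subrr !mulr0; apply: vle0.
apply: (vle_trans valB (good k.+1)); apply: vleM2l.
by rewrite [X in vle _ X _]exprS; apply: vleM2l; apply: conj_difference_pow.
Qed.

Lemma common_shift n (z : 'I_n -> L) : (forall j, exists c, B ((alpha - c%:A) * z j)) ->
  exists c, forall j, B ((alpha - c%:A) * z j).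
Proof.
have mono c c' y : vle B (alpha - c%:A) (alpha - c'%:A) ->
    B ((alpha - c%:A) * y) -> B ((alpha - c'%:A) * y).
  by move=> [b Bb ->] By; rewrite -mulrA; apply: intM.
elim: n z => [|n IHn] z Hz; first by exists 0 => -[].
have [c Hc] := IHn (z \o lift ord0) (fun j => Hz (lift ord0 j)).
have [c' Hc'] := Hz ord0.
have [le|le] := vle_total valB (alpha - c%:A) (alpha - c'%:A).
  by exists c' => j; case: (unliftP ord0 j) => [k ->|-> //]; apply: mono le (Hc k).
by exists c => j; case: (unliftP ord0 j) => [k ->|->]; [apply: Hc | apply: mono le Hc'].
Qed.

Lemma H_module_norm x (s : 'End(L)) : s =1 f -> J_sigma A s x -> H_module L A p (N x).
Proof.
move=> sf [n [c [b [Bc b0 ->]]]].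
have [|e He] := @common_shift n (fun j => f (b j) / b j - 1).
  by move=> j; apply: conj_ratio_bound.
have asE := AS_aut_shift e asH; set beta := alpha - e%:A in He asE.
set he := h - _ in asE; set x0 := \sum_(i < n) _.
have Nb : N beta = he.
  by apply: (@algL_inj _ L); rewrite (normLKE asE) (cnorm_alpha asE).
have b_neq0 : beta != 0 by rewrite subr_eq0; apply: (alpha_notin asH).
have he0 : he != 0 by rewrite -Nb (normLK_eq0 asH).
exists 1%N, (fun _ => N (beta * x0)), (fun _ => he); split.
- move=> _; apply: (normLK_int valA asH); rewrite /x0 mulr_sumr.
  apply: int_sum => // j _; rewrite mulrCA sf; apply: intM => //.
- by move=> _; split=> //; exists beta; rewrite (as_eq asE) (as_gen asE).
- by rewrite big_ord1 (normLKM asH) Nb mulrC mulKf.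
Qed.
End NormOfConjugateRatio.

(** * Module structure of H *)

Section HModule.
Variables (K : fieldType) (L : fieldExtType K) (A : K -> Prop) (p : nat).
Hypothesis valA : is_valuation_ring A.

Lemma H_module0 : H_module L A p 0.
Proof.
exists 0%N, (fun _ => 0), (fun _ => 0); split; [by case | by case | ].
by rewrite big_ord0.
Qed.

Lemma H_moduleD x y : H_module L A p x -> H_module L A p y -> H_module L A p (x + y).
Proof.
move=> [n [a [g [Aa Gg ->]]]] [m [b [k [Ab Gk ->]]]].
pose F T (u : 'I_n -> T) (v : 'I_m -> T) (i : 'I_(n + m)) :=
  match split i with inl j => u j | inr j => v j end.
exists (n + m)%N, (F _ a b), (F _ g k); split.
- by move=> i; rewrite /F; case: split.
- by move=> i; rewrite /F; case: split.
rewrite big_split_ord /=; congr (_ + _); apply: eq_bigr => i _; rewrite /F.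
  case: splitP => j e; first by congr (a _ / g _); apply: val_inj.
  by move: (ltn_ord i); rewrite [X in (X < _)%N]e ltnNge leq_addr.
case: splitP => j e; first by move: (ltn_ord j); rewrite -e ltnNge leq_addr.
by congr (b _ / k _); apply/val_inj/(@addnI n).
Qed.

Lemma H_moduleM a x : A a -> H_module L A p x -> H_module L A p (a * x).
Proof.
move=> Aa [n [b [g [Ab Gg ->]]]]; exists n, (fun i => a * b i), g; split=> //.
  by move=> i; apply: vringM.
by rewrite mulr_sumr; apply: eq_bigr => i _; rewrite mulrA.
Qed.
End HModule.

(** * Action of a Galois generator on Artin-Schreier roots *)

Section GaloisGenerator.
Variables (p : nat) (K : fieldType) (L : fieldExtType K).
Hypotheses (p_pr : prime p) (charK : p \in [pchar K]) (dimL : \dim {:L} = p).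
Variables (s : 'End(L)) (f : {lrmorphism L -> L}).
Hypotheses (gal_s : gal_generator s) (sf : s =1 f).
Local Notation mapL := (map_poly (in_alg L)).

Let charL : p \in [pchar L] := rmorph_pchar (in_alg L) charK.

Lemma frobenius_fixed (u : L) : u ^+ p = u -> exists2 n, (n < p)%N & u = n%:R.
Proof.
move=> uF; apply: contrapT => nex.
pose rs := u :: [seq n%:R | n <- iota 0 p] : seq L.
have q0 : 'X^p - 'X != 0 :> {poly L}.
  rewrite -size_poly_eq0 size_polyDl size_polyXn // size_polyN size_polyX.
  exact: prime_gt1.
have rs_root : all (root ('X^p - 'X)) rs.
  apply/allP => z; rewrite inE => /orP[/eqP->|/mapP[n _ ->]];
    by rewrite rootE !(hornerD, hornerN, hornerXn, hornerX) ?uF ?(natL_exp n charL) subrr.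
have rs_uniq : uniq rs.
  rewrite cons_uniq; apply/andP; split.
    apply/mapP => -[n]; rewrite mem_iota => np un; apply: nex; exists n => //.
  rewrite map_inj_in_uniq ?iota_uniq // => i j; rewrite !mem_iota => ip jp.
  exact: (natr_inj_pchar charL).
have := max_poly_roots q0 rs_root rs_uniq.
rewrite size_polyDl size_polyXn ?size_polyN ?size_polyX ?ltnS ?prime_gt1 //.
by rewrite /= size_map size_iota ltnn.
Qed.

(** By degree, X^p - X - h is the minimal polynomial of beta, and beta + 1 is another root of it. *)
Lemma kAut_translate (beta : L) (h : K) : beta ^+ p - beta = h%:A ->
  <<1%VS; beta>>%VS = fullv -> exists2 t : 'End(L), kAut 1%VS fullv t & t beta = beta + 1.
Proof.
move=> eqb gen; pose q : {poly L} := 'X^p - ('X + (h%:A)%:P).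
have sX : size ('X + (h%:A)%:P : {poly L}) = 2.
  by rewrite size_polyDl ?size_polyX // ltnS size_polyC_leq1.
have sq : size q = p.+1.
  by rewrite size_polyDl ?size_polyXn // size_polyN sX ltnS prime_gt1.
have q_over : q \is a polyOver 1%AS.
  apply: rpredB; first exact: polyOverXn.
  by apply: rpredD; [exact: polyOverX | rewrite polyOverC memvZ ?mem1v].
have q_root (z : L) : root q z = (z ^+ p - z == h%:A).
  by rewrite rootE !(hornerD, hornerN, hornerXn, hornerX, hornerC) opprD addrA subr_eq0.
have min_q : minPoly 1 beta %= q.
  rewrite -dvdp_size_eqp; last by apply: minPoly_dvdp => //; rewrite q_root eqb.
  by rewrite size_minPoly sq adjoin_degreeE gen dimL dimv1 divn1.
have min_root : root (map_poly (\1%VF : 'End(L)) (minPoly 1 beta)) (beta + 1).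
  rewrite lfun1_poly (eqp_root min_q) q_root -eqb.
  rewrite -(pFrobenius_autE charL) pFrobenius_autD_comm ?pFrobenius_autE; last exact: mulrC.
  by rewrite expr1n opprD addrACA subrr addr0.
exists (kHomExtend 1 \1 beta (beta + 1)).
  by rewrite kAutfE -gen; apply: kHomExtendP min_root => //; apply: kHom1.
by apply: (kHomExtend_val (kHom1 1 1)).
Qed.

(** f beta - beta is fixed by Frobenius, hence in the prime field. Were it 0, every power of s would
    fix beta, and translation by 1 would not be among them. *)
Lemma conj_generator (beta : L) (h : K) : beta ^+ p - beta = h%:A ->
  <<1%VS; beta>>%VS = fullv -> exists2 n, ~~ (p %| n)%N & f beta = beta + n%:R.
Proof.
move=> eqb gen; have [|n np e] := @frobenius_fixed (f beta - beta).
  rewrite -(pFrobenius_autE charL) pFrobenius_autB_comm ?pFrobenius_autE; last exact: mulrC.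
  have eqb' : beta ^+ p = beta + h%:A by rewrite -eqb addrC subrK.
  by rewrite -rmorphXn eqb' rmorphD /= linearZ /= rmorph1 opprD addrACA subrr addr0.
exists n; last by rewrite -e addrC subrK.
apply/negP => pn; have n0 : n = 0%N.
  by apply/eqP; move: np; rewrite ltnNge; apply: contraNT; rewrite -lt0n => /dvdn_leq; apply.
have [t t_aut tb] := kAut_translate eqb gen.
have [_ /(_ t t_aut) [m tE]] := gal_s.
have: t beta = beta.
  rewrite tE; elim: m {tE} => [|m IHm] /=; first by rewrite id_lfunE.
  by rewrite comp_lfunE IHm sf; apply/eqP; rewrite -subr_eq0 e n0.
by move/eqP; rewrite tb -subr_eq0 addrAC subrr add0r oner_eq0.
Qed.
End GaloisGenerator.

(** * The equality of ideals *)

Theorem theorem4p3p1 (p : nat) (K : fieldType) (L : fieldExtType K)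
  (A : K -> Prop) (s : 'End(L)) :
  prime p -> p \in [pchar K] ->
  is_valuation_ring A -> not_field A -> henselian A ->
  AS_extension L p -> gal_generator s ->
  forall y : K, H_module L A p y <-> norm_ideal A s y.
Proof.
move=> p_pr charK valA _ henA [dimL [alpha0 [/vlineP [h0 eq0] gen0]]] gal_s y.
have [s_aut _] := gal_s.
have sM : monoid_morphism s by apply/kHom_monoid_morphism; apply: kHom_kAut_sub s_aut.
pose sMx := GRing.isMonoidMorphism.Build L L s sM.
have [f sf] : exists f : {lrmorphism L -> L}, s =1 f.
  by exists (HB.pack (fun_of_lfun s) sMx : {lrmorphism L -> L}).
have scaled (beta : L) (h : K) : beta ^+ p - beta = h%:A -> <<1%VS; beta>>%VS = fullv ->
    exists2 n, ~~ (p %| n)%N & f beta = beta + n%:R /\ AS_aut p f (n%:R^-1 *: beta) (h / n%:R).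
  move=> eqb gen; have [n pn fb] := conj_generator p_pr charK dimL gal_s sf eqb gen.
  by exists n => //; split=> //; apply: (AS_aut_scale p_pr charK dimL gen eqb fb pn).
have [n0 _ [_ asH]] := scaled _ _ eq0 gen0.
(* The root beta / n is normalised and has norm h / n; the scalar 1/n has norm n^(-p) = 1/n, so the
   two factors cancel. *)
have N_gen (beta : L) (h : K) : beta ^+ p - beta = h%:A -> <<1%VS; beta>>%VS = fullv -> normLK beta = h.
  move=> eqb gen; have [n pn [_ asN]] := scaled _ _ eqb gen.
  have n_neq0 : n%:R != 0 :> K by rewrite -(dvdn_pcharf charK).
  have : normLK (n%:R^-1 *: beta) = h / n%:R.
    by apply: (@algL_inj _ L); rewrite (normLKE asN) (cnorm_alpha asN).
  rewrite -mulr_algl (normLKM asH) (normLK_alg asH) exprVn (natL_exp n charK) mulrC.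
  by apply: mulIf; rewrite invr_eq0.
split=> [[n [a [h [Aa Gh ->]]]] | [n [a [x [Aa Jx ->]]]]]; last first.
  elim/big_ind: _ => [|u v|i _]; [exact: H_module0 | exact: H_moduleD | ].
  by apply: H_moduleM => //; apply: (H_module_norm valA henA asH sf).
have /choice [beta Hb] : forall i, exists beta : L, beta ^+ p - beta = (h i)%:A /\ <<1%VS; beta>>%VS = fullv.
  by move=> i; have [_] := Gh i.
exists n, a, (fun i => (beta i)^-1); split=> // [i|]; last first.
  apply: eq_bigr => i _; have [eqb gen] := Hb i.
  by rewrite (normLKV asH) (N_gen _ _ eqb gen).
have [eqb gen] := Hb i; have [m pm [fb _]] := scaled _ _ eqb gen.
have m_neq0 : m%:R != 0 :> L by rewrite -(dvdn_pcharf (rmorph_pchar (in_alg L) charK)).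
have b0 : beta i != 0.
  by have [hi0 _] := Gh i; rewrite -(normLK_eq0 asH) (N_gen _ _ eqb gen).
exists 1%N, (fun _ => (m%:R^-1)%:A), (fun _ => beta i); split=> //.
  by move=> _; apply: int_alg => //; apply: (vring_natV valA charK).
rewrite big_ord1 sf fb mulrDl divff // addrC addKr algLV mulrA.
by rewrite scaler_nat mulVf ?mul1r.
Qed.
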